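(* Consider the exosystem $\dot v(t)=Sv(t)$, $v(t)\in\mathbb R^q$, $S\in\mathbb R^{q\times q}$, and $N$ agents indexed by $i\in\mathcal V_a=\{1,\dots,N\}$, each running the distributed observer $$\dot\eta_i(t)=S\eta_i(t)-\mu_1\hat\varsigma_i(t)-\mu_2\,\mathrm{sig}^\alpha(\hat\varsigma_i(t))-\mu_3\,\mathrm{sig}^\beta(\hat\varsigma_i(t)),\qquad \hat\varsigma_i(t)=\sum_{j=0}^N a_{ij}\vartheta(t)\big(\eta_i(t)-\eta_j(t)\big),$$ with $\eta_0(t)=v(t)$, over a directed graph under DoS attacks (setting described in the context). Suppose that (A1) the DoS attacks satisfy $|\Pi_D(t_0,t)|\le \nu_d+\frac{t-t_0}{p_d}$ for all $t\ge t_0$, with constants $\nu_d>0$, $p_d>1$; and (A2) the directed graph $\mathcal G$ contains a directed spanning tree with node $0$ as its root. Let $K=\mathrm{diag}\{k_1,\dots,k_N\}>0$ be a diagonal matrix with $\mathcal H^TK+K\mathcal H-2I_N\ge 0$ (such a $K$ exists under (A2)), and $k_M=\max_i k_i$. Given $\nu_d$ and $p_d$, suppose positive constants $\alpha,\beta,\mu_1,\mu_2,\mu_3$ satisfy $0<\alpha<1<\frac1\alpha<\beta$, $\mu_1>\|K\otimes S\|$, and define $c_1=\tfrac12\min\{\mu_1^2-\|K\otimes S\|^2,\ \mu_2^2,\ \mu_3^2(Nq)^{1-\beta}\}$, $c_2=\max\{\tfrac{\mu_1k_M}{2},\ \tfrac{\mu_2k_M}{\alpha+1}(Nq)^{\frac{1-\alpha}{2}},\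 \tfrac{\mu_3k_M}{\beta+1}\}$, $c_3=(3Nq)^{\frac{\beta-1}{\beta+1}}\big(\max\{\tfrac{\mu_1k_M}{2},\tfrac{\mu_2k_M}{\alpha+1},\tfrac{\mu_3k_M}{\beta+1}\}\big)^{\frac{2\beta}{\beta+1}}$, $c_4=\max\{(\tfrac{\mu_1k_M}{2})^{\frac{2\alpha}{\alpha+1}}(Nq)^{\frac{1-\alpha}{\alpha+1}},\ (\tfrac{\mu_2k_M}{\alpha+1})^{\frac{2\alpha}{\alpha+1}}(Nq)^{1-\alpha},\ (\tfrac{\mu_3k_M}{\beta+1})^{\frac{2\alpha}{\alpha+1}}\}$, $c_5=\max\{q^{\frac{1-\alpha}{2}},q^{\frac{\beta-1}{2}}\}\,\|S\|\,(\beta+1)$, $\hat c_1=\tfrac{c_1(1-\alpha)}{5c_4(\alpha+1)}$, $\hat c_2=\tfrac{c_5(1-\alpha)}{\alpha+1}$, $\tilde c_1=\tfrac{c_1(\beta-1)}{5c_2(\beta+1)}$, $\tilde c_2=\tfrac{c_5(\beta-1)}{\beta+1}$. Let $\bar t_o\in\mathbb R_+$ be the solution in $t$ of $$c_2e^{(\tilde c_1(p_d-1)-\tilde c_2)\frac{t-t_0}{p_d}-\tilde c_1\nu_d-\tilde c_2\nu_d}-c_2-c_3=0,$$ and $t_o\in\mathbb R_+$ the solution in $t$ of $$\hat c_2e^{\hat c_2(\frac{t-\bar t_o}{p_d}+\nu_d)}-\hat c_1(p_d-1)=0.$$ If (i) $\frac{c_1}{5c_2}(p_d-1)-c_5>0$,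 (ii) $\hat c_2e^{\hat c_2\nu_d}-\hat c_1(p_d-1)<0$, (iii) $e^{\hat c_2(\frac{t_o-\bar t_o}{p_d}+\nu_d)}-\frac{\hat c_1(p_d-1)}{p_d}(t_o-\bar t_o)+\hat c_1\nu_d\le 0$, then the estimation errors $\tilde\eta_i(t)=\eta_i(t)-v(t)$ converge to zero in fixed time: for every initial state of the observers and the exosystem, $\tilde\eta_i(t)=0$ for all $t\ge t_o$ and all $i\in\mathcal V_a$, where $$t_o=t_0+\frac{p_d\big(\ln(1+\frac{c_3}{c_2})+(\tilde c_1+\tilde c_2)\nu_d\big)}{\tilde c_1(p_d-1)-\tilde c_2}+\frac{p_d}{\hat c_2}\Big(\ln\Big(\frac{\hat c_1(p_d-1)}{\hat c_2}\Big)-\hat c_2\nu_d\Big),$$ which is independent of the initial states.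
   Context: Graph: a directed graph $\mathcal G=(\mathcal V,\mathcal E)$ with nodes $\mathcal V=\{0,1,\dots,N\}$, node $0$ being the exosystem and nodes $1,\dots,N$ the agents. $(j,i)\in\mathcal E$ means node $i$ receives information from node $j$. Adjacency matrix $\mathcal A=[a_{ij}]\in\mathbb R^{(N+1)\times(N+1)}$: $a_{ii}=0$, $a_{ij}>0$ if $(j,i)\in\mathcal E$, $a_{ij}=0$ otherwise. $\mathcal H=[h_{ij}]\in\mathbb R^{N\times N}$ with $h_{ii}=\sum_{j=1}^Na_{ij}+a_{i0}$ and $h_{ij}=-a_{ij}$ for $i\ne j$, $i,j\in\{1,\dots,N\}$. A directed spanning tree rooted at $0$ means every other node is reachable from node $0$ along a directed path. DoS attacks (zero-topology): starting at initial time $t_0$, the $k$-th attack ($k\in\mathbb N_+$) occupies $[t_k^a,t_k)$, with $t_{k-1}\le t_k^a<t_k$. $\vartheta(t)=1$ for $t\in[t_{k-1},t_k^a)$ and $\vartheta(t)=0$ for $t\in[t_k^a,t_k)$, so all communication links are cut during attacks. $\Pi_D(t_0,t)=\bigcup_{\{l:t_l^a\le t\}}[t_l^a,\min\{t_l,t\})$ is the total attacked set in $[t_0,t]$ and $|\Pi_D(t_0,t)|$ its length (Lebesgue measure). Notation: for $x\in\mathbb R^n$ and $c>0$, $\mathrm{sig}^c(x)=[\mathrm{sign}(x_1)|x_1|^c,\dots,\mathrm{sign}(x_n)|x_n|^c]^T$. $\otimes$ is the Kronecker product; $\|\cdot\|$ of a matrix is the induced Euclidean (spectral) norm. Solutions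 of discontinuous systems are understood in the Filippov sense. *)

(* Defs.v *)
From HB Require Import structures.
From mathcomp Require Import all_boot all_order all_algebra.
From mathcomp Require Import all_classical all_reals all_analysis.
From mathcomp Require Import mxtens.
Set Implicit Arguments. Unset Strict Implicit. Unset Printing Implicit Defensive.
Import Order.TTheory GRing.Theory Num.Theory.
Import numFieldNormedType.Exports.
Local Open Scope classical_set_scope.
Local Open Scope ring_scope.

Section Defs.
Variable R : realType.

Definition enorm n (x : 'cV[R]_n) : R := Num.sqrt (\sum_(l < n) x l 0 ^+ 2).

Definition specnorm m n (A : 'M[R]_(m, n)) : R :=
  sup [set r | exists x : 'cV[R]_n, enorm x <= 1 /\ r = enorm (A *m x)].

(* Kronecker product (mathcomp real_closed's tensmx, row index (i1,i2) |-> i1*p+i2) *)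
Definition kron m n p r (A : 'M[R]_(m, n)) (B : 'M[R]_(p, r)) : 'M[R]_(m * p, n * r)
  := tensmx A B.

Definition sigp n (c : R) (x : 'cV[R]_n) : 'cV[R]_n :=
  \col_l (Num.sg (x l 0) * (`|x l 0| `^ c)).

Definition psd n (M : 'M[R]_n) : Prop := forall x : 'cV[R]_n, 0 <= (x^T *m M *m x) 0 0.

(* node of agent i (agents 1..N are nodes lift ord0 i of 'I_N.+1; node 0 = ord0) *)
Definition agent N (i : 'I_N) : 'I_N.+1 := lift ord0 i.

(* adjacency matrix a : a i j > 0 iff (j,i) is an edge (i receives from j) *)
Definition adjacency N (a : 'M[R]_N.+1) : Prop :=
  (forall i, a i i = 0) /\ (forall i j, 0 <= a i j).

Definition has_spanning_tree_from0 N (a : 'M[R]_N.+1) : Prop :=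
  forall i : 'I_N.+1, connect (fun j i => 0 < a i j) ord0 i.

Definition Hmat N (a : 'M[R]_N.+1) : 'M[R]_N :=
  \matrix_(i, j) (if i == j
     then \sum_(l < N) a (agent i) (agent l) + a (agent i) ord0
     else - a (agent i) (agent j)).

(* DoS attacks: tk : nat -> R with tk 0 = t0, attack k (k >= 1) occupies [ta k, tk k) *)
Definition dos_schedule (t0 : R) (ta tk : nat -> R) : Prop :=
  tk 0%N = t0 /\
  (forall k : nat, (0 < k)%N -> tk k.-1 <= ta k /\ ta k < tk k) /\
  (forall T : R, exists k : nat, T <= tk k).

Definition attacked (ta tk : nat -> R) (t : R) : Prop :=
  exists k : nat, (0 < k)%N /\ ta k <= t /\ t < tk k.

Definition vartheta (ta tk : nat -> R) (t : R) : R :=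
  if `[< attacked ta tk t >] then 0 else 1.

Definition PiD (ta tk : nat -> R) (t : R) : set R :=
  \bigcup_(l in [set l : nat | (0 < l)%N /\ ta l <= t]) `[ta l, Num.min (tk l) t[%classic.

Definition switching (ta tk : nat -> R) (t : R) : Prop :=
  exists k : nat, t = ta k \/ t = tk k.

Definition ext N q (v : 'cV[R]_q) (eta : 'I_N -> 'cV[R]_q) (j : 'I_N.+1) : 'cV[R]_q :=
  match unlift ord0 j with Some i => eta i | None => v end.

Definition hatvarsigma N q (a : 'M[R]_N.+1) (th : R) (v : 'cV[R]_q)
  (eta : 'I_N -> 'cV[R]_q) (i : 'I_N) : 'cV[R]_q :=
  \sum_(j < N.+1) (a (agent i) j * th) *: (eta i - ext v eta j).

Definition observer_rhs N q (S : 'M[R]_q) (a : 'M[R]_N.+1) (mu1 mu2 mu3 alpha beta th : R)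
  (v : 'cV[R]_q) (eta : 'I_N -> 'cV[R]_q) (i : 'I_N) : 'cV[R]_q :=
  let s := hatvarsigma a th v eta i in
  S *m eta i - mu1 *: s - mu2 *: sigp alpha s - mu3 *: sigp beta s.

(* (eta, v) is a (Caratheodory = Filippov, the discontinuity being in t only)
   solution on [t0, +oo) of exosystem + observers *)
Definition is_solution N q (S : 'M[R]_q) (a : 'M[R]_N.+1) (mu1 mu2 mu3 alpha beta t0 : R)
  (ta tk : nat -> R) (v : R -> 'cV[R]_q) (eta : R -> 'I_N -> 'cV[R]_q) : Prop :=
  (forall t : R, is_derive t (1 : R) v (S *m v t)) /\
  (forall i, {within `[t0, +oo[%classic, continuous (fun s => eta s i)}) /\
  (forall t : R, t0 < t -> ~ switching ta tk t -> forall i,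
     is_derive t (1 : R) (fun s => eta s i)
       (observer_rhs S a mu1 mu2 mu3 alpha beta (vartheta ta tk t) (v t) (eta t) i)).

(* constants of the theorem; nKS = ||K (x) S||, nS = ||S||, kM = max k_i *)
Definition c1 (N q : nat) (mu1 mu2 mu3 beta nKS : R) : R :=
  2^-1 * Num.min (mu1 ^+ 2 - nKS ^+ 2)
           (Num.min (mu2 ^+ 2) (mu3 ^+ 2 * ((N * q)%:R `^ (1 - beta)))).
Definition c2 (N q : nat) (mu1 mu2 mu3 alpha beta kM : R) : R :=
  Num.max (mu1 * kM / 2)
    (Num.max (mu2 * kM / (alpha + 1) * ((N * q)%:R `^ ((1 - alpha) / 2)))
             (mu3 * kM / (beta + 1))).
Definition c3 (N q : nat) (mu1 mu2 mu3 alpha beta kM : R) : R :=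
  ((3 * N * q)%:R `^ ((beta - 1) / (beta + 1))) *
  (Num.max (mu1 * kM / 2) (Num.max (mu2 * kM / (alpha + 1)) (mu3 * kM / (beta + 1))))
    `^ (2 * beta / (beta + 1)).
Definition c4 (N q : nat) (mu1 mu2 mu3 alpha beta kM : R) : R :=
  Num.max (((mu1 * kM / 2) `^ (2 * alpha / (alpha + 1))) *
             ((N * q)%:R `^ ((1 - alpha) / (alpha + 1))))
   (Num.max (((mu2 * kM / (alpha + 1)) `^ (2 * alpha / (alpha + 1))) *
             ((N * q)%:R `^ (1 - alpha)))
            ((mu3 * kM / (beta + 1)) `^ (2 * alpha / (alpha + 1)))).
Definition c5 (q : nat) (alpha beta nS : R) : R :=
  Num.max (q%:R `^ ((1 - alpha) / 2)) (q%:R `^ ((beta - 1) / 2)) * nS * (beta + 1).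

End Defs.

(* Main.v *)
Require Import Defs.
From HB Require Import structures.
From mathcomp Require Import all_boot all_order all_algebra.
From mathcomp Require Import all_classical all_reals all_analysis.
From mathcomp Require Import mxtens ring lra.
Import Order.TTheory GRing.Theory Num.Theory.
Import numFieldNormedType.Exports.
Local Open Scope classical_set_scope.
Local Open Scope ring_scope.

(** Let [x = (H (x) I) (eta - 1 (x) v)] and let [V] be the sum over agents and
components of [k_i (mu1 x^2 / 2 + mu2 |x|^(alpha+1) / (alpha+1) + mu3
|x|^(beta+1) / (beta+1))]. The inequality on [K] and power-mean inequalities
give, with [p = 2 beta / (beta + 1)] and [r = 2 alpha / (alpha + 1)], the bounds
[V' <= - c1/5 (V/c2 + V^p/c3)] and [V' <= - c1/5 (V/c2 + V^r/c4)] outside the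
attacks, and [V' <= c5 V] during them.

Let [n] and [att] be the attack-free and attacked times elapsed since [t0],
[A = c1/(5 c2)], [psi = A n - c5 att] and [w = ln V]. With [kap = (beta - 1) /
(beta + 1)], the first bound makes [exp (- kap (w + psi)) + (c2/c3) exp (- kap
psi)] nondecreasing, hence [w + psi <= l] as soon as [psi >= l], where
[l = ln (1 + c3/c2) / kap]. With [h = (1 - alpha) / (1 + alpha)], the second
bound makes [exp (h (w + psi - l)) + hat_c1 n] nonincreasing while [psi >= l].
Condition (i) and (A1) give [psi >= l] once [n] has reached the value
[(tbar_o - t0) (p_d - 1) / p_d - nu_d]; from then on [n] still grows by at least
[(t_o - tbar_o) (p_d - 1) / p_d >= 1 / hat_c1] up to time [t_o], by (ii) and
(iii), so that [V] cannot stay positive. *)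

Set Implicit Arguments.
Unset Strict Implicit.

(** * Power-mean inequalities for finite sums of real powers *)

Section PowerSums.
Variable R : realType.
Implicit Types (x y z s a b : R).

Lemma ler_powR_base s x y : 0 <= s -> 0 <= x -> x <= y -> x `^ s <= y `^ s.
Proof.
move=> s0 x0 xy; apply: ge0_ler_powR => //; rewrite nnegrE //.
exact: le_trans xy.
Qed.

Lemma powR_le_interp a s1 s2 s : 0 <= a -> 0 < s1 -> s1 <= s -> s <= s2 ->
  a `^ s <= a `^ s1 + a `^ s2.
Proof.
move=> a0 s10 s1s ss2.
have [->|an0] := eqVneq a 0.
  rewrite powR0; last by rewrite gt_eqF // (lt_le_trans s10).
  by rewrite addr_ge0 ?powR_ge0.
have ap : 0 < a by rewrite lt_def an0.
have [a1|a1] := leP a 1.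
  rewrite (@le_trans _ _ (a `^ s1)) ?lerDl ?powR_ge0 //.
  by apply: ger_powR; rewrite ?ap.
rewrite (@le_trans _ _ (a `^ s2)) ?lerDr ?powR_ge0 //.
by apply: ler_powR => //; exact: ltW.
Qed.

(** Young's inequality for [x^s] and [1] with conjugate exponents [1/s] and [1/(1 - s)]. *)
Lemma powR_le_tangent x s : 0 <= x -> 0 < s -> s <= 1 -> x `^ s <= s * x + (1 - s).
Proof.
move=> x0 s0; rewrite le_eqVlt => /predU1P[->|s1].
  by rewrite powRr1 // mul1r subrr addr0.
have := @conjugate_powR R (x `^ s) 1 s^-1 (1 - s)^-1 (powR_ge0 _ _) ler01.
rewrite !invr_gt0 subr_gt0 !invrK addrC subrK => /(_ s0 s1 erefl).
by rewrite mulr1 -powRrM divff ?gt_eqF // powRr1 // powR1 mul1r mulrC.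
Qed.

Section Sums.
Variables (I : finType) (z : I -> R).
Hypothesis z0 : forall i, 0 <= z i.

Lemma sum_ge0 : 0 <= \sum_i z i. Proof. exact: sumr_ge0. Qed.

(** With [S] the sum, [S^s] is the sum of the [z i * S^(s - 1)], and [S^(s - 1) <= (z i)^(s - 1)]
    because [s - 1 <= 0] and [z i <= S]. *)
Lemma powR_sum_le s : 0 < s -> s <= 1 -> (\sum_i z i) `^ s <= \sum_i z i `^ s.
Proof.
move=> s0 s1.
have [->|Sn0] := eqVneq (\sum_i z i) 0.
  by rewrite powR0 ?gt_eqF // sumr_ge0 // => i _; exact: powR_ge0.
have Sp : 0 < \sum_i z i by rewrite lt_def Sn0 sum_ge0.
set S := \sum_i z i in Sn0 Sp *.
rewrite -(mulr_powRB1 (ltW Sp) s0) {1}/S mulr_suml; apply: ler_sum => i _.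
have [->|zn0] := eqVneq (z i) 0; first by rewrite mul0r powR_ge0.
have zp : 0 < z i by rewrite lt_def zn0 z0.
rewrite -(mulr_powRB1 (z0 i) s0) ler_pM2l //.
have -> : s - 1 = - (1 - s) by rewrite opprB.
rewrite !powRN lef_pV2 ?posrE ?powR_gt0 //.
apply: ler_powR_base => //; first by rewrite subr_ge0.
by rewrite /S (bigD1 i) //= lerDl sumr_ge0.
Qed.

(** Jensen's inequality: the tangent bound is applied to each [z i] relative to the mean [mu], and
    the linear terms add up to [s * m]. *)
Lemma sum_powR_le s : 0 < s -> s <= 1 ->
  \sum_i z i `^ s <= #|I|%:R `^ (1 - s) * (\sum_i z i) `^ s.
Proof.
move=> s0 s1.
have [S0|Sn0] := eqVneq (\sum_i z i) 0.
  rewrite big1 ?mulr_ge0 ?powR_ge0 // => i _.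
  have /eqP := S0; rewrite psumr_eq0 => [/allP/(_ i)|? _]; last exact: z0.
  by rewrite mem_index_enum => /(_ isT)/eqP ->; rewrite powR0 ?gt_eqF.
have Sp : 0 < \sum_i z i by rewrite lt_def Sn0 sum_ge0.
have m0 : 0 < (#|I|%:R : R).
  rewrite ltr0n lt0n; apply: contraNneq Sn0 => /card0_eq I0.
  by rewrite big1 // => i; have := I0 i.
set S := \sum_i z i in Sn0 Sp *; set m : R := #|I|%:R in m0 *.
pose mu := S / m.
have mup : 0 < mu by rewrite divr_gt0.
have zE i : z i `^ s <= mu `^ s * (s * (z i / mu) + (1 - s)).
  have zmu : 0 <= z i / mu by rewrite divr_ge0 // ltW.
  have -> : z i = mu * (z i / mu) by rewrite mulrC divfK ?gt_eqF.
  rewrite powRM ?(ltW mup) // (_ : mu * (z i / mu) / mu = z i / mu).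
    by rewrite ler_pM2l ?powR_gt0 //; exact: powR_le_tangent.
  by field; rewrite gt_eqF.
apply: le_trans (ler_sum _ (fun i _ => zE i)) _.
rewrite -mulr_sumr big_split /= -mulr_sumr -mulr_suml sumr_const -/S.
have -> : (1 - s) *+ #|I| = (1 - s) * m by rewrite mulr_natr.
have -> : S / mu = m by rewrite /mu; field; rewrite !gt_eqF.
have -> : s * m + (1 - s) * m = m by ring.
rewrite /mu powRM ?(ltW Sp) ?invr_ge0 ?(ltW m0) // -powR_inv1 ?(ltW m0) //.
rewrite -powRrM mulN1r -mulrA mulrC [X in _ <= X * _](_ : _ = m `^ (- s) * m) //.
rewrite powRD; last by rewrite (gt_eqF m0) implybT.
by rewrite powRr1 ?(ltW m0) // mulrC.
Qed.

End Sums.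

(** Subadditivity with exponent [1/s], applied to the numbers [(z i)^s]. *)
Lemma sum_powR_le_ge1 (I : finType) (z : I -> R) s : (forall i, 0 <= z i) -> 1 <= s ->
  \sum_i z i `^ s <= (\sum_i z i) `^ s.
Proof.
move=> z0 s1; have s0 : 0 < s by apply: lt_le_trans s1.
have := @powR_sum_le I (fun i => z i `^ s) (fun i => powR_ge0 _ _) s^-1.
rewrite invr_gt0 invf_le1 // => /(_ s0 s1).
under [X in _ <= X -> _]eq_bigr do rewrite -powRrM divff ?gt_eqF // powRr1 //.
move=> /(ler_powR_base (ltW s0) (powR_ge0 _ _)).
by rewrite -powRrM mulVf ?gt_eqF // powRr1 // sumr_ge0 // => i _; exact: powR_ge0.
Qed.

Lemma powR_sum_le_ge1 (I : finType) (z : I -> R) s : (forall i, 0 <= z i) -> 1 <= s ->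
  (\sum_i z i) `^ s <= #|I|%:R `^ (s - 1) * \sum_i z i `^ s.
Proof.
move=> z0 s1; have s0 : 0 < s by apply: lt_le_trans s1.
have := @sum_powR_le I (fun i => z i `^ s) (fun i => powR_ge0 _ _) s^-1.
rewrite invr_gt0 invf_le1 // => /(_ s0 s1).
under [X in X <= _ -> _]eq_bigr do rewrite -powRrM divff ?gt_eqF // powRr1 //.
have S0 : 0 <= \sum_i z i `^ s by apply: sumr_ge0 => i _; exact: powR_ge0.
move=> /(ler_powR_base (ltW s0) (sumr_ge0 _ (fun i _ => z0 i))).
rewrite powRM ?powR_ge0 // -!powRrM mulVf ?gt_eqF // powRr1 //.
by rewrite mulrBl mul1r mulVf ?gt_eqF.
Qed.

Lemma powR_sum3_le x y z s : 0 <= x -> 0 <= y -> 0 <= z -> 0 < s -> s <= 1 ->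
  (x + y + z) `^ s <= x `^ s + y `^ s + z `^ s.
Proof.
move=> x0 y0 z0 s0 s1.
have := @powR_sum_le 'I_3 (fun i => nth 0 [:: x; y; z] i) _ s s0 s1.
rewrite !big_ord_recl !big_ord0 /= !addr0 !addrA; apply.
by case=> [[|[|[|?]]]].
Qed.

Lemma powR_sum3_le_ge1 x y z s : 0 <= x -> 0 <= y -> 0 <= z -> 1 <= s ->
  (x + y + z) `^ s <= 3 `^ (s - 1) * (x `^ s + y `^ s + z `^ s).
Proof.
move=> x0 y0 z0 s1.
have := @powR_sum_le_ge1 'I_3 (fun i => nth 0 [:: x; y; z] i) s _ s1.
rewrite !big_ord_recl !big_ord0 /= !addr0 !addrA card_ord; apply.
by case=> [[|[|[|?]]]].
Qed.

End PowerSums.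

(** * Continuity on a subset of the line *)

Section WithinContinuous.
Variables (R : realType) (D : set R).
Implicit Types f g : R -> R.

Lemma within_continuousN f :
  {within D, continuous f} -> {within D, continuous (fun x => - f x)}.
Proof. by move=> cf z; apply: continuousN; exact: cf. Qed.

Lemma within_continuous_cst (c : R) : {within D, continuous (fun=> c)}.
Proof. by move=> z; exact: cvg_cst. Qed.

Lemma within_continuousZ (c : R) f :
  {within D, continuous f} -> {within D, continuous (fun x => c * f x)}.
Proof. by move=> cf z; apply: cvgMr; exact: cf. Qed.

Lemma within_continuous_sum (I : Type) (r : seq I) (F : I -> R -> R) :
  (forall i, {within D, continuous (F i)}) ->
  {within D, continuous (fun x => \sum_(i <- r) F i x)}.
Proof.
move=> cF; elim: r => [|i r IH].
  by under eq_fun do rewrite big_nil; exact: within_continuous_cst.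
by under eq_fun do rewrite big_cons; exact: within_continuousD.
Qed.

End WithinContinuous.

(** * Monotonicity off a finite set, and the two-phase extinction argument *)

Section Comparison.
Variable R : realType.

(** Induction on the exceptional list: the interval is cut at the head of the list when that point
    is interior, and continuity glues the halves. This carries estimates across switching
    instants. *)
Lemma nonincreasing_off_seq (s : seq R) (f : R -> R) (x y : R) :
  x <= y -> {within `[x, y], continuous f} ->
  (forall z, x < z < y -> z \notin s -> exists2 d, is_derive z (1 : R) f d & d <= 0) ->
  f y <= f x.
Proof.
elim: s x y => [|a s IH] x y xy cf df.
  have D z : z \in `]x, y[%R -> exists2 d, is_derive z (1 : R) f d & d <= 0.
    by rewrite in_itv /= => zxy; exact: df.
  apply: (@ler0_derive1_le_cc R f x y) => //; rewrite ?in_itv /= ?lexx ?xy //.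
  - by move=> z /D[d fd _]; exact: ex_derive.
  - by move=> z /D[d fd d0]; rewrite derive1E derive_val.
have [/andP[xa ay]|nxay] := boolP (x < a < y).
  apply: (@le_trans _ _ (f a)).
    apply: IH; first exact: ltW.
      by apply: continuous_subspaceW cf; apply: subset_itvr; rewrite bnd_simp ltW.
    move=> z /andP[az zy] zs; apply: df; first by rewrite (lt_trans xa).
    by rewrite inE negb_or zs andbT gt_eqF.
  apply: IH; first exact: ltW.
    by apply: continuous_subspaceW cf; apply: subset_itvl; rewrite bnd_simp ltW.
  move=> z /andP[xz za] zs; apply: df; first by rewrite xz (lt_trans za).
  by rewrite inE negb_or zs andbT lt_eqF.
apply: IH => // z zxy zs; apply: df => //; rewrite inE negb_or zs andbT.
by apply: contraNneq nxay => <-.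
Qed.

Section Extinction.
Variables (t0 t1 : R) (w n : R -> R) (s : seq R) (A C G rho kap h l : R).
Hypotheses (t01 : t0 <= t1) (rho_gt0 : 0 < rho) (C_ge0 : 0 <= C)
  (kap_gt0 : 0 < kap) (h_gt0 : 0 < h) (G_ge0 : 0 <= G)
  (lE : expR (kap * l) = 1 + rho).
Hypotheses (cw : {within `[t0, t1], continuous w})
  (cn : {within `[t0, t1], continuous n}) (n0 : n t0 = 0).
(** The two cases are an attack-free and an attacked instant. Dividing [V'] by [V] turns [V^p] and
    [V^r] into [expR (kap * w)] and [expR (- (h * w))]; with [rho = c3/c2], the coefficient
    [A / rho] is [c1/(5 c3)]. *)
Hypothesis dyn : forall z, t0 < z < t1 -> z \notin s ->
  exists2 d, is_derive z (1 : R) w d &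
    [/\ is_derive z (1 : R) n 1, d <= - (A + A / rho * expR (kap * w z))
      & d <= - (A + G * expR (- (h * w z)))]
    \/ is_derive z (1 : R) n 0 /\ d <= C.

Let psi z := A * n z - C * (z - t0 - n z).

Let dpsi z dn : is_derive z (1 : R) n dn -> is_derive z (1 : R) psi (A * dn - C * (1 - dn)).
Proof.
move=> nd; rewrite /psi.
have D1 : is_derive z (1 : R) (fun u => u - t0 - n u) (1 - dn).
  have D0 : is_derive z (1 : R) (fun u : R => u - t0) 1.
    by apply: is_derive_eq; rewrite ?subr0.
  exact: is_deriveB D0 nd.
exact: is_deriveB (is_deriveZ A nd) (is_deriveZ C D1).
Qed.

Let cpsi : {within `[t0, t1], continuous psi}.
Proof.
apply: within_continuousB; apply: within_continuousZ => //.
apply: within_continuousB => //; apply: within_continuousB.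
  by apply: (@continuous_subspaceT _ _ _ id) => u; exact: cvg_id.
exact: within_continuous_cst.
Qed.

Let dexpR (f : R -> R) z d :
  is_derive z (1 : R) f d -> is_derive z (1 : R) (expR \o f) (expR (f z) * d).
Proof. by move=> fd; apply: is_derive1_comp. Qed.

Let cexpR (f : R -> R) (D : set R) :
  {within D, continuous f} -> {within D, continuous (fun z => expR (f z))}.
Proof.
by move=> cf; apply: (within_continuous_comp D f expR) => // y _; exact: continuous_expR.
Qed.

(* [expR (- kap w) + 1 / rho] grows at least like [expR (kap psi)]. *)
Lemma level_reached z : t0 <= z <= t1 -> l <= psi z -> w z + psi z <= l.
Proof.
move=> /andP[t0z zt1] lpsi.
(* Minus [(expR (- kap w) + 1 / rho) * expR (- kap psi)], so that growth becomes a nonincreasing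
   function. *)
pose f u := - (expR (- kap * (w u + psi u)) + rho^-1 * expR (- kap * psi u)).
have sub : `[t0, z] `<=` `[t0, t1] by apply: subset_itvl; rewrite bnd_simp.
have cw' := continuous_subspaceW sub cw; have cp' := continuous_subspaceW sub cpsi.
have : f z <= f t0.
  apply: (@nonincreasing_off_seq s) => //.
    apply: within_continuousN; apply: within_continuousD.
      by apply: cexpR; apply: within_continuousZ; exact: within_continuousD.
    by apply: within_continuousZ; apply: cexpR; exact: within_continuousZ.
  move=> u /andP[t0u uz] us.
  have [|d wd H] := dyn _ us; first by rewrite t0u (lt_le_trans uz).
  have D dn : is_derive u (1 : R) n dn -> is_derive u (1 : R) f
     (- (expR (- kap * (w u + psi u)) * (- kap * (d + (A * dn - C * (1 - dn)))) +
        rho^-1 * (expR (- kap * psi u) * (- kap * (A * dn - C * (1 - dn)))))).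
    move=> /dpsi pd.
    have D1 := dexpR (is_deriveZ (- kap) (is_deriveD wd pd)).
    have D2 := dexpR (is_deriveZ (- kap) pd).
    exact: is_deriveN (is_deriveD D1 (is_deriveZ rho^-1 D2)).
  have E1 : - kap * (w u + psi u) = - kap * psi u + - (kap * w u) by ring.
  rewrite E1 expRD expRN in D.
  have := expR_gt0 (- kap * psi u); have := expR_gt0 (kap * w u).
  set X := expR (kap * w u) in H D *.
  set Y := expR (- kap * psi u) in D * => X0 Y0.
  case: H => [[/D D1 d1 _]|[/D D1 d1]]; (eexists; first exact: D1).
    rewrite subrr mulr0 subr0 mulr1.
    (* The summand [1 / rho] contributes exactly the term [A / rho * X] of the first decay bound. *)
    have -> : - (Y / X * (- kap * (d + A)) + rho^-1 * (Y * (- kap * A))) =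
       kap * Y / X * (d + (A + A / rho * X)) by field; rewrite !gt_eqF.
    by rewrite mulr_ge0_le0 ?mulr_ge0 ?invr_ge0 ?(ltW kap_gt0) ?(ltW X0) ?(ltW Y0) //; lra.
  rewrite mulr0 add0r subr0 mulr1.
  have -> : - (Y / X * (- kap * (d - C)) + rho^-1 * (Y * (- kap * - C))) =
     kap * Y / X * (d - C) - kap * Y / rho * C by ring.
  rewrite subr_le0 (@le_trans _ _ 0) //.
    by rewrite mulr_ge0_le0 ?mulr_ge0 ?invr_ge0 ?(ltW kap_gt0) ?(ltW X0) ?(ltW Y0) //; lra.
  by rewrite !mulr_ge0 ?invr_ge0 ?(ltW kap_gt0) ?(ltW rho_gt0) ?(ltW Y0).
rewrite /f lerN2 => fz.
have p0 : psi t0 = 0 by rewrite /psi n0; ring.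
(* The term in [w t0] is discarded by positivity alone, so the bound is independent of the initial
   state. *)
have F0 : rho^-1 <= expR (- kap * (w t0 + psi t0)) + rho^-1 * expR (- kap * psi t0).
  by rewrite p0 mulr0 expR0 mulr1 lerDr expR_ge0.
have pz : expR (- kap * psi z) <= (1 + rho)^-1.
  by rewrite -lE -expRN ler_expR mulNr lerN2 ler_pM2l.
have : expR (- (kap * l)) <= expR (- kap * (w z + psi z)).
  rewrite expRN lE.
  have : rho^-1 * expR (- kap * psi z) <= rho^-1 * (1 + rho)^-1.
    by rewrite ler_pM2l ?invr_gt0.
  have -> : rho^-1 * (1 + rho)^-1 = rho^-1 - (1 + rho)^-1.
    have r1 : 0 < 1 + rho by rewrite addr_gt0.
    by field; rewrite (gt_eqF r1) gt_eqF.
  lra.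
by rewrite ler_expR mulNr lerN2 ler_pM2l.
Qed.

Let n_incr x y : t0 <= x -> x <= y -> y <= t1 -> n x <= n y.
Proof.
move=> t0x xy yt1; rewrite -lerN2.
apply: (@nonincreasing_off_seq s (fun u => - n u)) => //.
  have sub : `[x, y] `<=` `[t0, t1] by apply: subset_itv; rewrite bnd_simp.
  by apply: within_continuousN; exact: (continuous_subspaceW sub cn).
move=> z /andP[xz zy] zs.
have [|d _ H] := dyn _ zs; first by rewrite (le_lt_trans t0x) //= (lt_le_trans zy).
by case: H => [[nd _ _]|[nd _]]; (eexists; [exact: is_deriveN nd|rewrite ?oppr0; lra]).
Qed.

(** Start at an instant [t2] where the attack-free time equals [nst]. There the exponential in [g]
    is at most [1] by the first phase. Afterwards [g] does not increase and its exponential stays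
    positive, so [h * G * n] cannot gain as much as [1]. *)
Lemma no_survival nst : 0 <= nst -> nst <= n t1 ->
  (forall z, t0 <= z <= t1 -> nst <= n z -> l <= psi z) ->
  h * G * (n t1 - nst) < 1.
Proof.
move=> nst0 nst1 Hpsi.
have [t2 t2i n2] : exists2 c, c \in `[t0, t1]%R & n c = nst.
  apply: IVT => //; rewrite n0.
  have n1 : 0 <= n t1 by apply: le_trans nst1.
  by rewrite min_l // max_r // nst0.
move: t2i; rewrite in_itv /= => /andP[t02 t21].
pose g u := expR (h * (w u + psi u - l)) + h * G * n u.
have sub : `[t2, t1] `<=` `[t0, t1] by apply: subset_itvr; rewrite bnd_simp.
have cw' := continuous_subspaceW sub cw; have cp' := continuous_subspaceW sub cpsi.
have : g t1 <= g t2.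
  apply: (@nonincreasing_off_seq s) => //.
    apply: within_continuousD.
      apply: cexpR; apply: within_continuousZ.
      apply: within_continuousB; last exact: within_continuous_cst.
      exact: within_continuousD.
    by apply: within_continuousZ; exact: (continuous_subspaceW sub cn).
  move=> u /andP[t2u ut1] us.
  have t0u : t0 < u by exact: le_lt_trans t2u.
  have [|d wd H] := dyn _ us; first by rewrite t0u.
  have D dn : is_derive u (1 : R) n dn -> is_derive u (1 : R) g
     (expR (h * (w u + psi u - l)) * (h * (d + (A * dn - C * (1 - dn)))) + h * G * dn).
    move=> nd; have pd := dpsi nd.
    have D0 := is_deriveB (is_deriveD wd pd) (is_derive_cst l u 1).
    have D1 := dexpR (is_deriveZ h D0); rewrite subr0 in D1.
    exact: is_deriveD D1 (is_deriveZ (h * G) nd).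
  have lp : l <= psi u.
    by apply: Hpsi; rewrite ?(ltW t0u) ?(ltW ut1) // -n2 n_incr // ltW.
  have E1 : h * (w u + psi u - l) = h * w u + h * (psi u - l) by ring.
  rewrite E1 expRD in D.
  have Z1 : 1 <= expR (h * (psi u - l)).
    by rewrite -expR0 ler_expR mulr_ge0 ?subr_ge0 // ltW.
  have := expR_gt0 (h * w u); rewrite expRN in H.
  set X := expR (h * w u) in H D *.
  set Z := expR (h * (psi u - l)) in Z1 D * => X0.
  have XZ : 0 <= X * Z * h by rewrite !mulr_ge0 ?(ltW X0) ?(ltW h_gt0) //; lra.
  case: H => [[/D D1 _ d1]|[/D D1 d1]]; (eexists; first exact: D1).
    (* The exponential loses at least [h * G * Z], which outweighs the gain [h * G] of the linear
       term since [Z >= 1]. *)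
    have : X * Z * (h * (d + A)) <= X * Z * h * - (G / X).
      by rewrite mulrA; apply: ler_wpM2l => //; lra.
    have -> : X * Z * h * - (G / X) = - (h * G * Z) by field; rewrite gt_eqF.
    have : h * G * 1 <= h * G * Z by apply: ler_wpM2l => //; rewrite mulr_ge0 // ltW.
    rewrite subrr mulr0 subr0 mulr1; lra.
  rewrite mulr0 add0r subr0 mulr1 mulr0 addr0 mulrA.
  by rewrite mulr_ge0_le0 //; lra.
have : expR (h * (w t2 + psi t2 - l)) <= 1.
  rewrite -expR0 ler_expR pmulr_rle0 // subr_le0.
  by apply: level_reached; rewrite ?t02 //; apply: Hpsi; rewrite ?t02 // n2.
have := expR_gt0 (h * (w t1 + psi t1 - l)).
rewrite /g n2 mulrBr; lra.
Qed.

End Extinction.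
End Comparison.

Lemma is_derive_bigsum (R : realType) (I : Type) (r : seq I) (F : I -> R -> R) (dF : I -> R)
    (x : R) :
  (forall i, is_derive x (1 : R) (F i) (dF i)) ->
  is_derive x (1 : R) (fun y => \sum_(i <- r) F i y) (\sum_(i <- r) dF i).
Proof.
move=> dFi; elim: r => [|i r IH].
  by under eq_fun do rewrite big_nil; rewrite big_nil; exact: is_derive_cst.
under eq_fun do rewrite big_cons.
by rewrite big_cons; exact: is_deriveD (dFi i) IH.
Qed.

(** * Elapsed length of a single attack *)

Section Clamp.
Variable R : realType.
Implicit Types a b z : R.

(** Length, at time [z], of the elapsed part of the attack [[a, b[]. *)
Definition clamp a b z : R := Num.max 0 (Num.min b z - a).

Lemma clamp_continuous a b : continuous (clamp a b).
Proof.
move=> z; apply: (@continuous_max R R^o (cst 0) (fun u => Num.min b u - a)).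
  exact: cvg_cst.
apply: cvgB; last exact: cvg_cst.
by apply: (@continuous_min R R^o (cst b) id); [exact: cvg_cst|exact: cvg_id].
Qed.

Lemma is_derive_clamp a b z : a < b -> z != a -> z != b ->
  is_derive z (1 : R) (clamp a b) ((a <= z < b)%R%:R).
Proof.
move=> ab; rewrite neq_lt => /orP[za _|az].
  rewrite leNgt za /= mulr0n.
  apply: (@near_eq_is_derive _ _ _ (cst 0)).
  near=> u; rewrite /clamp max_l // subr_le0 ge_min; apply/orP; right.
  by apply: ltW; near: u; exact: lt_nbhsl.
rewrite neq_lt => /orP[zb|bz].
  rewrite (ltW az) zb /=.
  apply: (@near_eq_is_derive _ _ _ (fun u => u - a)); last first.
    by apply: is_derive_eq; rewrite subr0 mulr1n.
  near=> u.
  have au : a < u by near: u; exact: lt_nbhsr.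
  have ub : u < b by near: u; exact: lt_nbhsl.
  by rewrite /clamp min_r ?(ltW ub) // max_r // subr_ge0 ltW.
rewrite [z < b]ltNge (ltW bz) andbF mulr0n.
apply: (@near_eq_is_derive _ _ _ (cst (b - a))).
near=> u.
have bu : b < u by near: u; exact: lt_nbhsr.
by rewrite /clamp min_l ?(ltW bu) // max_r // subr_ge0 ltW.
Unshelve. all: by end_near. Qed.

Lemma lebesgue_measure_clamp a b z :
  lebesgue_measure `[a, Num.min b z[%classic = (clamp a b z)%:E.
Proof.
rewrite lebesgue_measure_itv /= lte_fin /clamp.
case: ltP => H; first by rewrite max_r // subr_ge0 ltW.
by rewrite max_l // subr_le0.
Qed.

End Clamp.

(** * The attacked time as a clock *)

Section Attacks.
Variables (R : realType) (t0 : R) (ta tk : nat -> R).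
Hypothesis dos : dos_schedule t0 ta tk.

Let taS j : tk j <= ta j.+1. Proof. by have [_ [/(_ j.+1 isT)[]]] := dos. Qed.
Let tatk j : ta j.+1 < tk j.+1. Proof. by have [_ [/(_ j.+1 isT)[]]] := dos. Qed.

Let tk_homo i j : (i <= j)%N -> tk i <= tk j.
Proof.
move=> /subnK <-; elim: (j - i)%N => // d IH; rewrite addSn.
by apply: le_trans IH _; apply: le_trans (taS _) _; exact: ltW.
Qed.

Let attack_order i j z : (i < j)%N -> z < tk i.+1 -> ta j.+1 <= z -> False.
Proof.
move=> ij zi jz; have := le_lt_trans jz zi.
by rewrite ltNge (le_trans _ (taS j)) // tk_homo.
Qed.

(** Only the first [K] attacks are counted, which keeps the sum finite; before [tk K] no later
    attack has begun. *)
Definition attack_time (K : nat) (z : R) : R :=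
  \sum_(j < K) clamp (ta j.+1) (tk j.+1) z.

(** Distinct attacks are disjoint, so the lengths add up to the measure of a finite union contained
    in [PiD]. *)
Lemma attack_time_le_measure K z :
  ((attack_time K z)%:E <= lebesgue_measure (PiD ta tk z))%E.
Proof.
pose F (j : nat) : set R := `[ta j.+1, Num.min (tk j.+1) z[%classic.
have mF j : measurable (F j) by exact: measurable_itv.
have mU : measurable (\big[setU/set0]_(j < K) F j) by exact: bigsetU_measurable.
have tF : trivIset `I_K F.
  move=> i j _ _ [u []]; rewrite /F /= !in_itv /= !lt_min.
  move=> /andP[ai /andP[ui _]] /andP[aj /andP[uj _]].
  case: (ltngtP i j) => // lt; exfalso.
    exact: (attack_order lt ui aj).
  exact: (attack_order lt uj ai).
have -> : (attack_time K z)%:E = lebesgue_measure (\big[setU/set0]_(j < K) F j).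
  have -> : lebesgue_measure (\big[setU/set0]_(j < K) F j) =
      (\sum_(j < K) lebesgue_measure (F j))%E.
    by apply: measure_semi_additive_ord_I => // j _; exact: mF.
  rewrite /attack_time -sumEFin; apply: eq_bigr => j _.
  by rewrite -lebesgue_measure_clamp.
apply: le_measure; rewrite ?inE //.
  by apply: bigcup_measurable => j _; exact: measurable_itv.
rewrite -bigcup_mkord => u [j /= _ Fu].
have := Fu; rewrite /F /= in_itv /= lt_min => /andP[au /andP[_ uz]].
by exists j.+1; rewrite //=; split=> //; exact: ltW (le_lt_trans au uz).
Qed.

Lemma attack_time_continuous K D : {within D, continuous (attack_time K)}.
Proof.
apply: within_continuous_sum => j; apply: continuous_subspaceT.
exact: clamp_continuous.
Qed.

Lemma attack_time0 K : attack_time K t0 = 0.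
Proof.
rewrite /attack_time big1 // => j _; rewrite /clamp max_l // subr_le0 ge_min.
have [<- _] := dos.
by rewrite (le_trans (tk_homo (leq0n j))) ?orbT.
Qed.

Lemma is_derive_attack_time K z : z < tk K -> ~ switching ta tk z ->
  is_derive z (1 : R) (attack_time K) (1 - vartheta ta tk z).
Proof.
move=> zK nsw.
(* The sum counts the attacks containing [z]. By disjointness there is at most one, and [z < tk K]
   places it among the first [K]. *)
have -> : 1 - vartheta ta tk z = \sum_(j < K) (ta j.+1 <= z < tk j.+1)%R%:R.
  rewrite /vartheta; case: asboolP => [[[|j] [j0 [aj jz]]]|natt]; first by [].
    have jK : (j < K)%N.
      rewrite ltnNge; apply/negP => Kj.
      have := lt_le_trans zK (tk_homo Kj).
      by rewrite ltNge (le_trans (taS j) aj).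
    rewrite (bigD1 (Ordinal jK)) //= aj jz big1 ?subr0 ?addr0 // => i.
    move=> /eqP neq; case: andP => // -[ai iz]; exfalso; apply: neq; apply: val_inj => /=.
    case: (ltngtP i j) => // lt; exfalso.
      exact: (attack_order lt iz aj).
    exact: (attack_order lt jz ai).
  rewrite subrr big1 // => i _; case: andP => // -[ai iz].
  by exfalso; apply: natt; exists i.+1.
apply: is_derive_bigsum => j; apply: is_derive_clamp => //; apply/eqP => E; apply: nsw.
  by exists j.+1; left.
by exists j.+1; right.
Qed.

(** An attack of index above [K] starts no earlier than [tk K], so the exceptional instants before
    [tk K] form a finite list. *)
Lemma switching_mem K z : z < tk K -> switching ta tk z ->
  z \in [seq ta j | j <- iota 0 K.+1] ++ [seq tk j | j <- iota 0 K.+1].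
Proof.
move=> zK [j zE]; rewrite mem_cat; apply/orP.
have [jK|Kj] := leqP j K.
  by case: zE => ->; [left|right]; rewrite map_f // mem_iota.
case: zE => zE; exfalso; move: zK; apply/negP; rewrite -leNgt zE.
  by case: j Kj {zE} => // j Kj; rewrite (le_trans _ (taS j)) // tk_homo.
by rewrite tk_homo // ltnW.
Qed.

Lemma attack_clock T : exists (att : R -> R) (s : seq R),
  [/\ {within `[t0, T], continuous att}, att t0 = 0,
     (forall z, ((att z)%:E <= lebesgue_measure (PiD ta tk z))%E) &
     forall z, z < T -> z \notin s -> ~ switching ta tk z /\
       is_derive z (1 : R) att (1 - vartheta ta tk z)].
Proof.
(* The schedule is not Zeno: the ends of the attacks are unbounded. *)
have [_ [_ /(_ T)[K TK]]] := dos.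
exists (attack_time K), ([seq ta j | j <- iota 0 K.+1] ++ [seq tk j | j <- iota 0 K.+1]).
split; [exact: attack_time_continuous|exact: attack_time0
  |exact: attack_time_le_measure|].
move=> z zT zs; have zK := lt_le_trans zT TK.
have nsw : ~ switching ta tk z by move=> /(switching_mem zK); apply/negP.
by split=> //; exact: is_derive_attack_time.
Qed.

End Attacks.

(** * Powers of the Lyapunov function against powers of the energy *)

Section Rates.
(** Here [a] stands for the energy, [M] for [N q], and [m1], [m2], [m3] for the coefficients in the
    bound of the Lyapunov function. *)
Variables (R : realType) (m1 m2 m3 M alpha beta a V : R).
Hypotheses (m1_gt0 : 0 < m1) (m2_gt0 : 0 < m2) (m3_gt0 : 0 < m3) (M_ge1 : 1 <= M)
  (alpha_gt0 : 0 < alpha) (alpha_lt1 : alpha < 1) (alpha_beta : 1 < alpha * beta)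
  (a_ge0 : 0 <= a) (V_ge0 : 0 <= V)
  (V_le : V <= m1 * a + m2 * M `^ ((1 - alpha) / 2) * a `^ ((alpha + 1) / 2)
               + m3 * a `^ ((beta + 1) / 2)).

Let beta_gt1 : 1 < beta.
Proof.
have b0 : 0 < beta by rewrite -(pmulr_rgt0 _ alpha_gt0); apply: lt_trans alpha_beta.
by apply: (lt_trans alpha_beta); rewrite -[ltRHS]mul1r ltr_pM2r.
Qed.

Let interp (s1 s2 s : R) : 0 < s1 -> s1 <= s -> s <= s2 -> a `^ s <= a `^ s1 + a `^ s2.
Proof. exact: powR_le_interp. Qed.

Let a1 : a `^ 1 = a. Proof. exact: powRr1. Qed.

Let half1 : a `^ ((alpha + 1) / 2) <= a `^ alpha + a.
Proof.
move: (alpha_gt0) (alpha_lt1) (alpha_beta) => al_gt0 al_lt1 al_be.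
by rewrite -[X in _ <= _ + X]a1; apply: interp; lra.
Qed.

Let half2 : a `^ ((beta + 1) / 2) <= a + a `^ beta.
Proof.
by have := beta_gt1; rewrite -[X in _ <= X + _]a1 => b1; apply: interp; lra.
Qed.

(** Each half exponent lies between neighbours among [alpha, 1, beta]. The coefficients [3, 1, 1]
    obtained here, added to those of either nonlinear bound, stay at most [5]: this is the [5] in
    the decay rates. *)
Lemma linear_rate :
  V / Num.max m1 (Num.max (m2 * M `^ ((1 - alpha) / 2)) m3) <= 3 * a + a `^ alpha + a `^ beta.
Proof.
set C2 := Num.max _ _.
have C20 : 0 < C2 by rewrite lt_max m1_gt0.
rewrite ler_pdivrMr // mulrC; apply: (le_trans V_le).
apply: (@le_trans _ _ (C2 * (a + a `^ ((alpha + 1) / 2) + a `^ ((beta + 1) / 2)))).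
  rewrite !mulrDr; apply: lerD; first apply: lerD.
  - by rewrite ler_wpM2r // le_max lexx.
  - by rewrite ler_wpM2r ?powR_ge0 // !le_max lexx orbT.
  - by rewrite ler_wpM2r ?powR_ge0 // !le_max lexx !orbT.
rewrite ler_pM2l //; have := half1; have := half2; lra.
Qed.

(** Convexity of the power [p >= 1] splits [V^p] into three powers of [a] with exponents in
    [[1, beta]]. *)
Lemma superlinear_rate :
  V `^ (2 * beta / (beta + 1)) /
    ((3 * M) `^ ((beta - 1) / (beta + 1)) *
      Num.max m1 (Num.max m2 m3) `^ (2 * beta / (beta + 1))) <= 2 * a + 3 * a `^ beta.
Proof.
move: (alpha_gt0) (alpha_lt1) (alpha_beta) => al_gt0 al_lt1 al_be; have M1 := M_ge1.
set Q := Num.max _ _; set p := 2 * beta / (beta + 1).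
have b1 := beta_gt1; have b10 : 0 < beta + 1 by lra.
have Q0 : 0 < Q by rewrite lt_max m1_gt0.
have pE : (beta - 1) / (beta + 1) = p - 1 by rewrite /p; field; rewrite gt_eqF.
have p1 : 1 <= p by rewrite /p ler_pdivlMr //; lra.
have pb : p <= beta by rewrite /p ler_pdivrMr //; nra.
have p0 : 0 <= p by apply: le_trans p1.
have M0 : 0 <= M by apply: le_trans M_ge1.
rewrite pE ler_pdivrMr ?mulr_gt0 ?powR_gt0 //; last by lra.
set W := a + M `^ ((1 - alpha) / 2) * a `^ ((alpha + 1) / 2) + a `^ ((beta + 1) / 2).
have VW : V <= Q * W.
  apply: (le_trans V_le); rewrite /W !mulrDr -mulrA; apply: lerD; first apply: lerD.
  - by rewrite ler_wpM2r // le_max lexx.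
  - by rewrite ler_wpM2r ?mulr_ge0 ?powR_ge0 // !le_max lexx orbT.
  - by rewrite ler_wpM2r ?powR_ge0 // !le_max lexx !orbT.
have W0 : 0 <= W by rewrite !addr_ge0 ?mulr_ge0 ?powR_ge0.
apply: (le_trans (ler_powR_base p0 V_ge0 VW)).
rewrite (powRM _ (ltW Q0) W0) mulrA [leRHS]mulrC ler_pM2l ?powR_gt0 // [leRHS]mulrC.
apply: (le_trans (@powR_sum3_le_ge1 _ _ _ _ p _ _ _ p1));
  rewrite ?mulr_ge0 ?powR_ge0 //.
rewrite (@powRM _ 3) // -mulrA ler_pM2l ?powR_gt0 // powRM ?powR_ge0 // -!powRrM.
have -> : (beta + 1) / 2 * p = beta by rewrite /p; field; rewrite gt_eqF.
have Mp : 1 <= M `^ (p - 1) by rewrite -[X in X <= _](powRr0 M); apply: ler_powR => //; lra.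
(* The condition [1 / alpha < beta] enters here: it lets [M^(p - 1)] absorb the factor
   [M^((1 - alpha) / 2)] of the middle term, raised to the power [p]. *)
have Ma : M `^ ((1 - alpha) / 2 * p) <= M `^ (p - 1).
  apply: ler_powR => //; rewrite -pE /p.
  rewrite -subr_ge0 (_ : _ - _ = (alpha * beta - 1) / (beta + 1)).
    by rewrite divr_ge0 ?(ltW b10) //; lra.
  by field; rewrite gt_eqF.
have e1 : a `^ p <= a + a `^ beta by rewrite -[X in _ <= X + _]a1; exact: interp.
have e2 : a `^ ((alpha + 1) / 2 * p) <= a + a `^ beta.
  have E : (alpha + 1) / 2 * p = (alpha * beta + beta) / (beta + 1).
    by rewrite /p; field; rewrite gt_eqF.
  rewrite -[X in _ <= X + _]a1 E; apply: interp => //.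
    by rewrite ler_pdivlMr //; lra.
  by rewrite ler_pdivrMr //; nra.
apply: (@le_trans _ _ (M `^ (p - 1) * (a `^ p + a `^ ((alpha + 1) / 2 * p) + a `^ beta))).
  rewrite !mulrDr; apply: lerD; first apply: lerD.
  - by rewrite ler_peMl ?powR_ge0.
  - by rewrite ler_wpM2r ?powR_ge0.
  - by rewrite ler_peMl ?powR_ge0.
rewrite ler_wpM2l ?powR_ge0 //; lra.
Qed.

(** The power [r <= 1] is subadditive, and the exponents it produces lie in [[alpha, beta]]; the
    last one is at least [1] because [alpha * beta > 1]. *)
Lemma sublinear_rate :
  V `^ (2 * alpha / (alpha + 1)) /
    Num.max (m1 `^ (2 * alpha / (alpha + 1)) * M `^ ((1 - alpha) / (alpha + 1)))
      (Num.max (m2 `^ (2 * alpha / (alpha + 1)) * M `^ (1 - alpha))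
        (m3 `^ (2 * alpha / (alpha + 1)))) <= 2 * a + 2 * a `^ alpha + a `^ beta.
Proof.
move: (alpha_gt0) (alpha_lt1) (alpha_beta) => al_gt0 al_lt1 al_be.
set r := 2 * alpha / (alpha + 1); set C4 := Num.max _ _.
have b1 := beta_gt1; have al1 : 0 < alpha + 1 by lra.
have M0 : 0 <= M by apply: le_trans M_ge1.
have C40 : 0 < C4 by rewrite !lt_max powR_gt0 ?orbT.
have r0 : 0 < r by rewrite /r divr_gt0 //; lra.
have r1 : r <= 1 by rewrite /r ler_pdivrMr //; lra.
have ar : alpha <= r by rewrite /r ler_pdivlMr //; nra.
rewrite ler_pdivrMr // mulrC.
apply: (le_trans (ler_powR_base (ltW r0) V_ge0 V_le)).
apply: (le_trans (powR_sum3_le _ _ _ r0 r1));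
  rewrite ?mulr_ge0 ?powR_ge0 ?(ltW m1_gt0) ?(ltW m2_gt0) ?(ltW m3_gt0) //.
rewrite !powRM ?mulr_ge0 ?powR_ge0 ?(ltW m1_gt0) ?(ltW m2_gt0) ?(ltW m3_gt0) //.
rewrite -!powRrM.
have -> : (alpha + 1) / 2 * r = alpha by rewrite /r; field; rewrite gt_eqF.
have e1 : a `^ r <= a `^ alpha + a by rewrite -[X in _ <= _ + X]a1; exact: interp.
have e3 : a `^ ((beta + 1) / 2 * r) <= a + a `^ beta.
  have E : (beta + 1) / 2 * r = (alpha * beta + alpha) / (alpha + 1).
    by rewrite /r; field; rewrite gt_eqF.
  rewrite -[X in _ <= X + _]a1 E; apply: interp => //.
    by rewrite ler_pdivlMr //; lra.
  by rewrite ler_pdivrMr //; nra.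
apply: (@le_trans _ _ (C4 * (a `^ r + a `^ alpha + a `^ ((beta + 1) / 2 * r)))).
  rewrite !mulrDr; apply: lerD; first apply: lerD.
  - rewrite ler_wpM2r ?powR_ge0 // le_max ler_peMr ?powR_ge0 //.
    rewrite -[X in X <= _](powRr0 M); apply: ler_powR => //.
    by rewrite divr_ge0 ?(ltW al1) //; lra.
  - rewrite ler_wpM2r ?powR_ge0 // !le_max ler_wpM2l ?powR_ge0 ?orbT //.
    by apply: ler_powR => //; nra.
  - by rewrite ler_wpM2r ?powR_ge0 // !le_max lexx !orbT.
rewrite ler_pM2l //; lra.
Qed.

End Rates.

(** * Euclidean and spectral norms, Kronecker product and the matrix inequality *)

Section Norms.
Variable R : realType.

Lemma enorm_ge0 n (x : 'cV[R]_n) : 0 <= enorm x.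
Proof. exact: sqrtr_ge0. Qed.

Lemma sqr_enorm n (x : 'cV[R]_n) : enorm x ^+ 2 = \sum_l x l 0 ^+ 2.
Proof. by rewrite sqr_sqrtr // sumr_ge0 // => l _; exact: sqr_ge0. Qed.

Lemma enorm_eq0 n (x : 'cV[R]_n) : enorm x = 0 -> x = 0.
Proof.
move=> x0; have := sqr_enorm x; rewrite x0 expr0n /= => /esym/eqP.
rewrite psumr_eq0 => [/allP xl0|l _]; last exact: sqr_ge0.
apply/matrixP => l j; rewrite (ord1 j) mxE.
by have := xl0 l; rewrite mem_index_enum sqrf_eq0 => /(_ isT)/eqP.
Qed.

Lemma enormZ n c (x : 'cV[R]_n) : enorm (c *: x) = `|c| * enorm x.
Proof.
rewrite /enorm -sqrtr_sqr -sqrtrM ?sqr_ge0 // mulr_sumr; congr Num.sqrt.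
by apply: eq_bigr => l _; rewrite mxE exprMn.
Qed.

Lemma enorm_coord n (x : 'cV[R]_n) l : `|x l 0| <= enorm x.
Proof.
rewrite -sqrtr_sqr; apply: ler_wsqrtr; rewrite (bigD1 l) //= lerDl sumr_ge0 // => i _.
exact: sqr_ge0.
Qed.

Let specset m n (A : 'M[R]_(m, n)) :=
  [set r | exists x : 'cV[R]_n, enorm x <= 1 /\ r = enorm (A *m x)].

Let specset0 m n (A : 'M[R]_(m, n)) : specset A 0.
Proof.
exists 0; rewrite mulmx0.
have e0 p : enorm (0 : 'cV[R]_p) = 0.
  by rewrite -(scale0r 0) enormZ normr0 mul0r.
by rewrite !e0.
Qed.

Let specset_sup m n (A : 'M[R]_(m, n)) : has_sup (specset A).
Proof.
split; first by exists 0; exact: specset0.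
(* A crude bound from [|x j| <= 1], which makes [sup] a true supremum rather than its default
   value. *)
exists (Num.sqrt (\sum_i (\sum_j `|A i j|) ^+ 2)) => _ [x [x1 ->]].
apply: ler_wsqrtr; apply: ler_sum => i _.
rewrite -real_normK ?num_real // ler_sqr ?nnegrE ?normr_ge0 ?sumr_ge0 //.
rewrite mxE; apply: le_trans (ler_norm_sum _ _ _) _; apply: ler_sum => j _.
by rewrite normrM ler_piMr // (le_trans (enorm_coord x j)).
Qed.

Lemma specnorm_ge0 m n (A : 'M[R]_(m, n)) : 0 <= specnorm A.
Proof. by apply: sup_ubound; [case: (specset_sup A)|exact: specset0]. Qed.

Lemma enorm_mulmx m n (A : 'M[R]_(m, n)) x : enorm (A *m x) <= specnorm A * enorm x.
Proof.
have [x0|xn0] := eqVneq (enorm x) 0.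
  by rewrite x0 (enorm_eq0 x0) mulmx0 mulr0 -(scale0r 0) enormZ normr0 mul0r.
have xp : 0 < enorm x by rewrite lt_def xn0 enorm_ge0.
rewrite -ler_pdivrMr //; apply: sup_ubound; first by case: (specset_sup A).
exists ((enorm x)^-1 *: x); rewrite -scalemxAr !enormZ ger0_norm ?invr_ge0 ?(ltW xp) //.
by rewrite mulVf // mulrC.
Qed.

Lemma cauchy_schwarz n (x y : 'cV[R]_n) :
  \sum_l x l 0 * y l 0 <= enorm x * enorm y.
Proof.
have [x0|xn0] := eqVneq (enorm x) 0.
  rewrite x0 (enorm_eq0 x0) mul0r big1 // => l _; by rewrite mxE mul0r.
have [y0|yn0] := eqVneq (enorm y) 0.
  rewrite y0 (enorm_eq0 y0) mulr0 big1 // => l _; by rewrite mxE mulr0.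
have xp : 0 < enorm x by rewrite lt_def xn0 enorm_ge0.
have yp : 0 < enorm y by rewrite lt_def yn0 enorm_ge0.
set X := enorm x in xn0 xp *; set Y := enorm y in yn0 yp *.
have H l : x l 0 * y l 0 <= X * Y / 2 * (x l 0 ^+ 2 / X ^+ 2 + y l 0 ^+ 2 / Y ^+ 2).
  have -> : X * Y / 2 * (x l 0 ^+ 2 / X ^+ 2 + y l 0 ^+ 2 / Y ^+ 2) =
     X * Y / 2 * (x l 0 / X - y l 0 / Y) ^+ 2 + x l 0 * y l 0.
    by field; rewrite xn0 yn0.
  by rewrite lerDr mulr_ge0 ?sqr_ge0 // !mulr_ge0 ?invr_ge0 ?ltW.
apply: (le_trans (ler_sum _ (fun l _ => H l))).
rewrite -mulr_sumr big_split /= -!mulr_suml -!sqr_enorm -/X -/Y.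
have -> : X * Y / 2 * (X ^+ 2 / X ^+ 2 + Y ^+ 2 / Y ^+ 2) = X * Y by field; rewrite xn0 yn0.
exact: lexx.
Qed.

(** When the blocks [x i] are stacked into [z], the Kronecker product maps [z] to the blocks
    [k i * S x i], so the operator norm applies. *)
Lemma kron_diag_le N q (k : 'I_N -> R) (S : 'M[R]_q) (x : 'I_N -> 'cV[R]_q) :
  \sum_i \sum_l (k i * (S *m x i) l 0) ^+ 2 <=
  specnorm (kron (diag_mx (\row_i k i)) S) ^+ 2 * \sum_i \sum_l x i l 0 ^+ 2.
Proof.
pose z : 'cV[R]_(N * q) := \col_u x (mxtens_unindex u).1 (mxtens_unindex u).2 0.
have reidx (F : 'I_N -> 'I_q -> R) :
    \sum_(u < N * q) F (mxtens_unindex u).1 (mxtens_unindex u).2 = \sum_i \sum_l F i l.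
  rewrite pair_bigA /= (reindex (@mxtens_unindex N q)) //=.
  by exists (@mxtens_index N q) => u _; rewrite (mxtens_indexK, mxtens_unindexK).
have KS i l : (kron (diag_mx (\row_i k i)) S *m z) (mxtens_index (i, l)) 0 =
    k i * (S *m x i) l 0.
  rewrite mxE.
  under eq_bigr => u _ do rewrite !mxE mxtens_indexK /=.
  rewrite (reidx (fun i' l' => k i *+ (i == i') * S l l' * x i' l' 0)).
  rewrite (bigD1 i) //= [X in _ + X]big1 => [|i' /negPf]; last first.
    by rewrite eq_sym => ->; rewrite big1 // => l' _; rewrite mulr0n !mul0r.
  by rewrite addr0 eqxx mxE mulr_sumr; apply: eq_bigr => l' _; rewrite mulr1n mulrA.
rewrite -(reidx (fun i l => x i l 0 ^+ 2)) -(reidx (fun i l => (k i * (S *m x i) l 0) ^+ 2)).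
have <- : enorm z ^+ 2 = \sum_(u < N * q) x (mxtens_unindex u).1 (mxtens_unindex u).2 0 ^+ 2.
  by rewrite sqr_enorm; apply: eq_bigr => u _; rewrite mxE.
rewrite -exprMn.
apply: le_trans (_ : enorm (kron (diag_mx (\row_i k i)) S *m z) ^+ 2 <= _).
  rewrite sqr_enorm; apply: ler_sum => u _.
  by rewrite -KS -surjective_pairing mxtens_unindexK.
rewrite ler_sqr ?nnegrE ?mulr_ge0 ?enorm_ge0 ?specnorm_ge0 //.
exact: enorm_mulmx.
Qed.

(** The scalars [x^T H^T K x] and [x^T K H x] are transposes of each other, hence equal, so the
    hypothesis bounds twice the latter from below by [2 |x|^2]. *)
Lemma psd_quadratic_le N (H : 'M[R]_N) (k : 'I_N -> R) :
  psd (H^T *m diag_mx (\row_i k i) + diag_mx (\row_i k i) *m H - 2%:M) ->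
  forall f : 'I_N -> R, \sum_i f i ^+ 2 <= \sum_i k i * f i * \sum_j H i j * f j.
Proof.
move=> HK f; pose x : 'cV[R]_N := \col_i f i; set K := diag_mx _ in HK.
have KH : (x^T *m (K *m H) *m x) 0 0 = \sum_i k i * f i * \sum_j H i j * f j.
  rewrite -mulmxA -mulmxA (mulmxA x^T) mxE; apply: eq_bigr => i _.
  rewrite mul_mx_diag !mxE (mulrC (f i)); congr (_ * _).
  by apply: eq_bigr => j _; rewrite !mxE.
have HK' : (x^T *m (H^T *m K) *m x) 0 0 = (x^T *m (K *m H) *m x) 0 0.
  have -> : x^T *m (H^T *m K) *m x = (x^T *m (K *m H) *m x)^T.
    by rewrite !trmx_mul trmxK tr_diag_mx !mulmxA.
  by rewrite mxE.
have xx : (x^T *m 2%:M *m x) 0 0 = 2 * \sum_i f i ^+ 2.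
  rewrite mul_mx_scalar -scalemxAl mxE; congr (_ * _); rewrite mxE.
  by apply: eq_bigr => i _; rewrite !mxE expr2.
have := HK x; rewrite mulmxBr mulmxDr mulmxBl mulmxDl.
rewrite [X in 0 <= X -> _]mxE [X in 0 <= _ + X -> _]mxE [X in 0 <= X + _ -> _]mxE.
rewrite HK' KH xx; lra.
Qed.

End Norms.

(** * Signed powers of a real number *)

Section SignedPower.
Variable R : realType.

Definition sgpow (c y : R) : R := Num.sg y * `|y| `^ c.

Lemma powR_abs (y c : R) : `|y| `^ c = (y ^+ 2) `^ (c / 2).
Proof.
by rewrite -real_normK ?num_real // -powR_mulrn // -powRrM mulrC divfK.
Qed.

(** The exponent must be nonzero: at [y = 0] the left side vanishes, while [0] to the power [0] is
    [1]. *)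
Lemma sqr_sgpow (c y : R) : c != 0 -> sgpow c y ^+ 2 = (y ^+ 2) `^ c.
Proof.
move=> c0; have [->|y0] := eqVneq y 0.
  by rewrite /sgpow sgr0 mul0r expr0n /= powR0.
rewrite /sgpow exprMn sqr_sg y0 mul1r powR_abs -[LHS]powR_mulrn ?powR_ge0 // -powRrM.
by congr (_ `^ _); field.
Qed.

Lemma sgpow_mul_ge0 (c d y : R) : 0 <= sgpow c y * sgpow d y.
Proof.
rewrite /sgpow mulrACA -expr2; apply: mulr_ge0; first exact: sqr_ge0.
by rewrite mulr_ge0 ?powR_ge0.
Qed.

Lemma is_derive_norm_powR (c y : R) : 0 < c ->
  is_derive y (1 : R) (fun z => `|z| `^ (c + 1)) ((c + 1) * sgpow c y).
Proof.
move=> c0; rewrite /sgpow.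
have [y0|y0|->] := ltrgt0P y.
- rewrite gtr0_sg // mul1r.
  apply: (@near_eq_is_derive _ _ _ (fun z => z `^ (c + 1))).
    near=> z; have z0 : 0 < z by near: z; exact: lt_nbhsr.
    by rewrite gtr0_norm.
  by have := @is_derive1_powR R (c + 1) y y0; rewrite addrK.
- rewrite ltr0_sg // mulN1r mulrN -mulrN1.
  apply: (@near_eq_is_derive _ _ _ ((fun z => z `^ (c + 1)) \o -%R)).
    near=> z; have z0 : z < 0 by near: z; exact: lt_nbhsl.
    by rewrite ltr0_norm.
  apply: is_derive1_comp.
  by have := @is_derive1_powR R (c + 1) (- y); rewrite oppr_gt0 addrK; apply.
- rewrite sgr0 mul0r mulr0.
  (* At the origin the difference quotient has absolute value [|h|^c], which is below [e] once
     [|h| < e^(1/c)]. *)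
  pose f (z : R) : R := `|z| `^ (c + 1).
  suff H : (fun h : R => h^-1 *: (f (h *: (1 : R) + 0) - f 0)) @ 0^' --> (0 : R).
    by apply: DeriveDef; [apply/cvg_ex; exists 0|exact: cvg_lim].
  rewrite /f normr0 powR0; last by rewrite gt_eqF // addr_gt0.
  apply/cvgr0Pnorm_lt => e e0.
  have ec : 0 < e `^ c^-1 by exact: powR_gt0.
  near=> h.
  have h0 : h != 0 by near: h; exact: nbhs_dnbhs_neq.
  have he : `|h| < e `^ c^-1 by near: h; exact: dnbhs0_lt.
  rewrite subr0 addr0 [h *: 1]mulr1 normrZ normrV ?unitfE //.
  rewrite (ger0_norm (powR_ge0 _ _)) powRD; last by rewrite normr_eq0 h0 implybT.
  rewrite powRr1 // mulrC mulfK ?normr_eq0 //.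
  have -> : e = (e `^ c^-1) `^ c by rewrite -powRrM mulVf ?gt_eqF // powRr1 // ltW.
  by apply: gt0_ltr_powR; rewrite ?nnegrE // ltW.
Unshelve. all: by end_near. Qed.

End SignedPower.

(** * The scalar feedback and its primitive *)

Section Potential.
Variables (R : realType) (mu1 mu2 mu3 alpha beta : R).

(** The feedback of the observer acting on one component; [potential] is its primitive. *)
Definition force (y : R) : R := mu1 * y + mu2 * sgpow alpha y + mu3 * sgpow beta y.

Definition potential (y : R) : R := mu1 / 2 * y ^+ 2
  + mu2 / (alpha + 1) * `|y| `^ (alpha + 1) + mu3 / (beta + 1) * `|y| `^ (beta + 1).

Lemma is_derive_potential (y : R) : 0 < alpha -> 0 < beta ->
  is_derive y (1 : R) potential (force y).
Proof.
move=> al0 be0.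
have D1 : is_derive y (1 : R) (fun z : R => z ^+ 2) (2 * y).
  by apply: is_derive_eq; rewrite /GRing.scale /=; ring.
have D2 := is_derive_norm_powR y al0; have D3 := is_derive_norm_powR y be0.
have D := is_deriveD (is_deriveD (is_deriveZ (mu1 / 2) D1)
  (is_deriveZ (mu2 / (alpha + 1)) D2)) (is_deriveZ (mu3 / (beta + 1)) D3).
apply: (is_derive_eq D); rewrite /GRing.scale /= /force; field.
by rewrite !gt_eqF // addr_gt0.
Qed.

Lemma potential_continuous : 0 < alpha -> 0 < beta -> continuous potential.
Proof.
move=> al0 be0 y; apply: differentiable_continuous; apply/derivable1_diffP.
exact: (@ex_derive _ _ _ _ _ _ _ (is_derive_potential y al0 be0)).
Qed.

Let frac_mul_ge0 (c d e : R) : 0 <= c -> 0 < d -> 0 <= e -> 0 <= c / d * e.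
Proof. by move=> c0 d0 e0; rewrite mulr_ge0 // divr_ge0 // ltW. Qed.

Lemma potential_ge0 (y : R) : 0 < alpha -> 0 < beta -> 0 <= mu1 -> 0 <= mu2 -> 0 <= mu3 ->
  0 <= potential y.
Proof.
move=> al0 be0 h1 h2 h3.
by rewrite addr_ge0 // ?addr_ge0 // frac_mul_ge0 ?sqr_ge0 ?powR_ge0 ?addr_gt0.
Qed.

Lemma potential_eq0 (y : R) : 0 < alpha -> 0 < beta -> 0 < mu1 -> 0 <= mu2 -> 0 <= mu3 ->
  potential y = 0 -> y = 0.
Proof.
move=> al0 be0 h1 h2 h3 p0; apply/eqP; rewrite -sqrf_eq0 eq_le sqr_ge0 andbT.
rewrite -(pmulr_rle0 _ (_ : 0 < mu1 / 2)) ?divr_gt0 // -p0 /potential -addrA lerDl.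
by rewrite addr_ge0 // frac_mul_ge0 ?powR_ge0 ?addr_gt0.
Qed.

(** The three terms of the force share the sign of [y], so the cross products in the square are
    nonnegative. *)
Lemma sqr_force_ge (y : R) : 0 < alpha -> 0 < beta -> 0 <= mu1 -> 0 <= mu2 -> 0 <= mu3 ->
  mu1 ^+ 2 * y ^+ 2 + mu2 ^+ 2 * (y ^+ 2) `^ alpha + mu3 ^+ 2 * (y ^+ 2) `^ beta
  <= force y ^+ 2.
Proof.
move=> al0 be0 h1 h2 h3.
have ysg : y = sgpow 1 y by rewrite /sgpow powRr1 // -numEsg.
have c1 := sgpow_mul_ge0 1 alpha y; have c2 := sgpow_mul_ge0 1 beta y.
have c3 := sgpow_mul_ge0 alpha beta y.
rewrite -!sqr_sgpow ?gt_eqF // /force -ysg in c1 c2 *.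
have -> : (mu1 * y + mu2 * sgpow alpha y + mu3 * sgpow beta y) ^+ 2 =
  mu1 ^+ 2 * y ^+ 2 + mu2 ^+ 2 * sgpow alpha y ^+ 2 + mu3 ^+ 2 * sgpow beta y ^+ 2 +
  2 * (mu1 * mu2 * (y * sgpow alpha y) + mu1 * mu3 * (y * sgpow beta y)
       + mu2 * mu3 * (sgpow alpha y * sgpow beta y)) by ring.
rewrite lerDl; apply: mulr_ge0 => //.
by apply: addr_ge0; [apply: addr_ge0|]; (apply: mulr_ge0 => //; exact: mulr_ge0).
Qed.

(** Growth during an attack, term by term: Cauchy-Schwarz separates [S x] from the powers, power
    means restore the sums of the potential at the cost of a power of [q], and [beta + 1] dominates
    the denominators of the potential. *)
Lemma force_attack_le q (S : 'M[R]_q) (x : 'cV[R]_q) : (0 < q)%N ->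
  0 < alpha -> alpha < 1 -> 1 < beta -> 0 <= mu1 -> 0 <= mu2 -> 0 <= mu3 ->
  \sum_l force (x l 0) * (S *m x) l 0 <=
  c5 q alpha beta (specnorm S) * \sum_l potential (x l 0).
Proof.
move=> q0 al0 al1 be1 h1 h2 h3.
have be0 : 0 < beta by lra.
have q1 : 1 <= (q%:R : R) by rewrite ler1n.
set nS := specnorm S; have nS0 : 0 <= nS by exact: specnorm_ge0.
set Q := Num.max (q%:R `^ ((1 - alpha) / 2)) (q%:R `^ ((beta - 1) / 2)).
have Q1 : 1 <= Q.
  rewrite le_max -[X in X <= _](powRr0 q%:R); apply/orP; left.
  by apply: ler_powR => //; lra.
have Qa : q%:R `^ ((1 - alpha) / 2) <= Q by rewrite le_max lexx.
have Qb : q%:R `^ ((beta - 1) / 2) <= Q by rewrite le_max lexx orbT.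
have c5E : c5 q alpha beta nS = Q * nS * (beta + 1) by [].
pose s := \sum_l x l 0 ^+ 2.
have s0 : 0 <= s by apply: sumr_ge0 => l _; exact: sqr_ge0.
have x20 l : 0 <= x l 0 ^+ 2 by exact: sqr_ge0.
have es : enorm x = s `^ 2^-1 by rewrite powR12_sqrt.
have CS (f : R -> R) : \sum_l f (x l 0) * (S *m x) l 0 <=
    nS * s `^ 2^-1 * (\sum_l f (x l 0) ^+ 2) `^ 2^-1.
  have := cauchy_schwarz (\col_l f (x l 0)) (S *m x).
  under eq_bigr do rewrite mxE; move=> /le_trans; apply.
  rewrite mulrC ler_pM ?enorm_ge0 //; first by rewrite -es enorm_mulmx.
  rewrite powR12_sqrt; last by apply: sumr_ge0 => l _; exact: sqr_ge0.
  by rewrite /enorm; under eq_bigr do rewrite mxE.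
have T1 : \sum_l x l 0 * (S *m x) l 0 <= nS * s.
  apply: (le_trans (CS id)); rewrite -mulrA -powRD.
    by rewrite -/s (_ : 2^-1 + 2^-1 = 1) ?powRr1 //; field.
  by rewrite gt_eqF //; lra.
have T2 : \sum_l sgpow alpha (x l 0) * (S *m x) l 0 <=
    nS * (Q * \sum_l `|x l 0| `^ (alpha + 1)).
  apply: (le_trans (CS (sgpow alpha))); rewrite -mulrA ler_wpM2l //.
  under eq_bigr do rewrite sqr_sgpow ?gt_eqF //.
  under [X in _ <= _ * X]eq_bigr do rewrite powR_abs.
  have Sa := @sum_powR_le R _ (fun l => x l 0 ^+ 2) x20 alpha al0 (ltW al1).
  have Sb := @powR_sum_le R _ (fun l => x l 0 ^+ 2) x20 ((alpha + 1) / 2).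
  rewrite -/s card_ord in Sa Sb.
  apply: (@le_trans _ _ (s `^ 2^-1 * (q%:R `^ (1 - alpha) * s `^ alpha) `^ 2^-1)).
    rewrite ler_wpM2l ?powR_ge0 // ler_powR_base ?invr_ge0 //.
    by apply: sumr_ge0 => l _; exact: powR_ge0.
  rewrite powRM ?powR_ge0 // -!powRrM mulrCA -powRD.
    have -> : 2^-1 + alpha / 2 = (alpha + 1) / 2 by field.
    by rewrite ler_pM ?powR_ge0 // Sb //; lra.
  by rewrite gt_eqF //; lra.
(* Unlike for [alpha], the power of [q] now comes from [s^((beta + 1) / 2)] and not from the squared
   signed powers. *)
have T3 : \sum_l sgpow beta (x l 0) * (S *m x) l 0 <=
    nS * (Q * \sum_l `|x l 0| `^ (beta + 1)).
  apply: (le_trans (CS (sgpow beta))); rewrite -mulrA ler_wpM2l //.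
  under eq_bigr do rewrite sqr_sgpow ?gt_eqF //.
  under [X in _ <= _ * X]eq_bigr do rewrite powR_abs.
  have Sa := @sum_powR_le_ge1 R _ (fun l => x l 0 ^+ 2) beta x20 (ltW be1).
  have Sb := @powR_sum_le_ge1 R _ (fun l => x l 0 ^+ 2) ((beta + 1) / 2) x20.
  rewrite -/s card_ord in Sa Sb.
  apply: (@le_trans _ _ (s `^ 2^-1 * (s `^ beta) `^ 2^-1)).
    rewrite ler_wpM2l ?powR_ge0 // ler_powR_base ?invr_ge0 //.
    by apply: sumr_ge0 => l _; exact: powR_ge0.
  rewrite -!powRrM -powRD.
    have -> : 2^-1 + beta / 2 = (beta + 1) / 2 by field.
    apply: (le_trans (Sb _)); first by lra.
    have -> : (beta + 1) / 2 - 1 = (beta - 1) / 2 by field.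
    rewrite ler_wpM2r // sumr_ge0 // => l _; exact: powR_ge0.
  by rewrite gt_eqF //; lra.
have -> : \sum_l force (x l 0) * (S *m x) l 0 =
    mu1 * (\sum_l x l 0 * (S *m x) l 0) + mu2 * (\sum_l sgpow alpha (x l 0) * (S *m x) l 0)
    + mu3 * \sum_l sgpow beta (x l 0) * (S *m x) l 0.
  rewrite !mulr_sumr -!big_split /=; apply: eq_bigr => l _; rewrite /force; ring.
have -> : \sum_l potential (x l 0) = mu1 / 2 * s +
    mu2 / (alpha + 1) * (\sum_l `|x l 0| `^ (alpha + 1)) +
    mu3 / (beta + 1) * (\sum_l `|x l 0| `^ (beta + 1)).
  by rewrite !mulr_sumr -!big_split.
have A0 : 0 <= \sum_l `|x l 0| `^ (alpha + 1) by apply: sumr_ge0 => l _; exact: powR_ge0.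
have B0 : 0 <= \sum_l `|x l 0| `^ (beta + 1) by apply: sumr_ge0 => l _; exact: powR_ge0.
rewrite !mulrDr c5E; apply: lerD; first apply: lerD.
- apply: (le_trans (ler_wpM2l h1 T1)).
  have -> : Q * nS * (beta + 1) * (mu1 / 2 * s) = mu1 * (nS * s) * (Q * ((beta + 1) / 2)).
    by field.
  by rewrite ler_peMr ?mulr_ge0 // mulr_ege1 //; lra.
- apply: (le_trans (ler_wpM2l h2 T2)); set A := \sum_l _ in A0 *.
  have -> : Q * nS * (beta + 1) * (mu2 / (alpha + 1) * A) =
      mu2 * (nS * (Q * A)) * ((beta + 1) / (alpha + 1)).
    by field; rewrite gt_eqF //; lra.
  rewrite ler_peMr ?mulr_ge0 //; first by lra.
  by rewrite ler_pdivlMr ?addr_gt0 //; lra.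
- apply: (le_trans (ler_wpM2l h3 T3)); set B := \sum_l _ in B0 *.
  have -> : Q * nS * (beta + 1) * (mu3 / (beta + 1) * B) = mu3 * (nS * (Q * B)).
    by field; rewrite gt_eqF //; lra.
  exact: lexx.
Qed.

End Potential.

(** * The Lyapunov function and its rate with and without attack *)

Section Lyapunov.
Variables (R : realType) (N q : nat) (S : 'M[R]_q) (k : 'I_N -> R) (H : 'M[R]_N)
  (mu1 mu2 mu3 alpha beta : R).
Hypotheses (k_gt0 : forall i, 0 < k i) (N_gt0 : (0 < N)%N) (q_gt0 : (0 < q)%N).
Hypotheses (mu1_gt0 : 0 < mu1) (mu2_gt0 : 0 < mu2) (mu3_gt0 : 0 < mu3)
  (alpha_gt0 : 0 < alpha) (alpha_lt1 : alpha < 1) (beta_gt1 : 1 < beta).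
Implicit Type x : 'I_N -> 'cV[R]_q.

Let F := force mu1 mu2 mu3 alpha beta.
Let K := diag_mx (\row_i k i).
Let kM := \big[Num.max/0]_(i < N) k i.

Definition lyap x : R := \sum_i k i * \sum_l potential mu1 mu2 mu3 alpha beta (x i l 0).

Definition energy x : R := \sum_i \sum_l x i l 0 ^+ 2.

Let energyE x : energy x = \sum_(p : 'I_N * 'I_q) x p.1 p.2 0 ^+ 2.
Proof. by rewrite /energy pair_bigA. Qed.

Lemma energy_ge0 x : 0 <= energy x.
Proof. by do 2 (apply: sumr_ge0 => ? _); exact: sqr_ge0. Qed.

Lemma lyap_ge0 x : 0 <= lyap x.
Proof.
apply: sumr_ge0 => i _; apply: mulr_ge0; first exact: ltW.
by apply: sumr_ge0 => l _; apply: potential_ge0; rewrite ?(ltW mu1_gt0) ?(ltW mu2_gt0)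
  ?(ltW mu3_gt0) // (lt_trans _ beta_gt1).
Qed.

Lemma lyap_eq0 x : lyap x = 0 -> forall i, x i = 0.
Proof.
have p0 y : 0 <= potential mu1 mu2 mu3 alpha beta y.
  apply: potential_ge0; rewrite ?(ltW mu1_gt0) ?(ltW mu2_gt0) ?(ltW mu3_gt0) //.
  by rewrite (lt_trans _ beta_gt1).
move=> V0 i; apply/matrixP => l j; rewrite (ord1 j) mxE.
apply: (@potential_eq0 _ mu1 mu2 mu3 alpha beta);
  rewrite ?(ltW mu2_gt0) ?(ltW mu3_gt0) ?(lt_trans _ beta_gt1) //.
have Vi0 (i' : 'I_N) : 0 <= k i' * \sum_l potential mu1 mu2 mu3 alpha beta (x i' l 0).
  by apply: mulr_ge0; [exact: ltW|exact: sumr_ge0].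
have /eqP := V0; rewrite psumr_eq0 // => /allP/(_ i); rewrite mem_index_enum => /(_ isT).
rewrite mulf_eq0 gt_eqF //= psumr_eq0 // => /allP/(_ l).
by rewrite mem_index_enum => /(_ isT)/eqP.
Qed.

Let M_ge1 : 1 <= ((N * q)%:R : R).
Proof. by rewrite ler1n muln_gt0 N_gt0. Qed.

(** Power means over the [N q] components: the exponent [(alpha + 1) / 2 < 1] costs a power of
    [N q], the exponent [(beta + 1) / 2 > 1] costs nothing. *)
Lemma lyap_le_energy x :
  lyap x <= mu1 * kM / 2 * energy x
    + mu2 * kM / (alpha + 1) * (N * q)%:R `^ ((1 - alpha) / 2) * energy x `^ ((alpha + 1) / 2)
    + mu3 * kM / (beta + 1) * energy x `^ ((beta + 1) / 2).
Proof.
move: (alpha_gt0) (alpha_lt1) (beta_gt1) => al0 al1 be1.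
have be0 : 0 < beta by lra.
have x20 (p : 'I_N * 'I_q) : 0 <= x p.1 p.2 0 ^+ 2 by exact: sqr_ge0.
have kM0 : 0 <= kM by exact: bigmax_ge_id.
apply: (@le_trans _ _ (kM * \sum_(p : 'I_N * 'I_q) potential mu1 mu2 mu3 alpha beta (x p.1 p.2 0))).
  rewrite -(pair_bigA _ (fun i l => potential mu1 mu2 mu3 alpha beta (x i l 0))) /=.
  rewrite mulr_sumr; apply: ler_sum => i _; rewrite ler_wpM2r //; last exact: le_bigmax.
  by apply: sumr_ge0 => l _; apply: potential_ge0; rewrite ?(ltW mu1_gt0) ?(ltW mu2_gt0)
    ?(ltW mu3_gt0).
rewrite !big_split /= -!mulr_sumr -energyE !mulrDr.
under [X in _ + kM * (_ * X) + _]eq_bigr do rewrite powR_abs.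
under [X in _ + kM * (_ * X)]eq_bigr do rewrite powR_abs.
have Sa := @sum_powR_le R _ (fun p : 'I_N * 'I_q => x p.1 p.2 0 ^+ 2) x20 ((alpha + 1) / 2).
have Sb := @sum_powR_le_ge1 R _ (fun p : 'I_N * 'I_q => x p.1 p.2 0 ^+ 2) ((beta + 1) / 2) x20.
rewrite -energyE card_prod !card_ord in Sa Sb.
have E1 : 1 - (alpha + 1) / 2 = (1 - alpha) / 2 by field.
rewrite E1 in Sa.
apply: lerD; first apply: lerD.
- by rewrite le_eqVlt; apply/orP; left; apply/eqP; ring.
- have -> : forall X Y, mu2 * kM / (alpha + 1) * X * Y = kM * (mu2 / (alpha + 1) * (X * Y)).
    by move=> X Y; ring.
  rewrite ler_wpM2l // ler_wpM2l ?Sa //; try lra.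
  by rewrite divr_ge0 ?(ltW mu2_gt0) //; lra.
- have -> : forall X, mu3 * kM / (beta + 1) * X = kM * (mu3 / (beta + 1) * X).
    by move=> X; ring.
  rewrite ler_wpM2l // ler_wpM2l ?Sb //; try lra.
  by rewrite divr_ge0 ?(ltW mu3_gt0) //; lra.
Qed.

(** Derivative of [lyap] along [x_i' = S x_i - th * sum_j H i j * F (x_j)], where [th] is [0] under
    attack and [1] otherwise. *)
Definition lyap_rate th x : R := \sum_i k i * \sum_l F (x i l 0) *
  ((S *m x i) l 0 - th * \sum_j H i j * F (x j l 0)).

Lemma lyap_rate_attack x :
  lyap_rate 0 x <= c5 q alpha beta (specnorm S) * lyap x.
Proof.
rewrite /lyap_rate /lyap mulr_sumr; apply: ler_sum => i _.
rewrite mulrCA ler_pM2l //; under eq_bigr do rewrite mul0r subr0.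
by apply: force_attack_le; rewrite ?(ltW mu1_gt0) ?(ltW mu2_gt0) ?(ltW mu3_gt0).
Qed.

(** With [f = F(x)] and [Y i = k i * S x i], the matrix inequality bounds the rate by
    [f . Y - |f|^2] and Young's inequality by [(|Y|^2 - |f|^2) / 2]. The spectral norm bounds [|Y|],
    which leaves [mu1^2 - nKS^2] in front of the energy. *)
Lemma lyap_rate_free x : psd (H^T *m K + K *m H - 2%:M) ->
  lyap_rate 1 x <= - (c1 N q mu1 mu2 mu3 beta (specnorm (kron K S)) *
    (energy x + energy x `^ alpha + energy x `^ beta)).
Proof.
move=> psdH; set nKS := specnorm _.
move: (alpha_gt0) (alpha_lt1) (beta_gt1) => al0 al1 be1.
have be0 : 0 < beta by lra.
have x20 (p : 'I_N * 'I_q) : 0 <= x p.1 p.2 0 ^+ 2 by exact: sqr_ge0.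
pose Y i l := k i * (S *m x i) l 0.
pose f i l := F (x i l 0).
have -> : lyap_rate 1 x = \sum_i \sum_l f i l * Y i l
    - \sum_l \sum_i k i * f i l * \sum_j H i j * f j l.
  rewrite [X in _ - X]exchange_big /= -sumrB; apply: eq_bigr => i _.
  rewrite mulr_sumr -sumrB; apply: eq_bigr => l _; rewrite mul1r /f /Y; ring.
have quad : \sum_i \sum_l f i l ^+ 2 <=
    \sum_l \sum_i k i * f i l * \sum_j H i j * f j l.
  rewrite exchange_big /=; apply: ler_sum => l _.
  exact: (psd_quadratic_le psdH (f^~ l)).
have cross : \sum_i \sum_l f i l * Y i l <=
    2^-1 * (\sum_i \sum_l f i l ^+ 2) + 2^-1 * (\sum_i \sum_l Y i l ^+ 2).
  rewrite -mulrDr -big_split mulr_sumr; apply: ler_sum => i _.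
  rewrite -big_split mulr_sumr; apply: ler_sum => l _ /=.
  by have := sqr_ge0 (f i l - Y i l); rewrite sqrrB; lra.
have nY : \sum_i \sum_l Y i l ^+ 2 <= nKS ^+ 2 * energy x by exact: kron_diag_le.
have Sa := @powR_sum_le R _ (fun p : 'I_N * 'I_q => x p.1 p.2 0 ^+ 2) x20 alpha al0 (ltW al1).
have Sb := @powR_sum_le_ge1 R _ (fun p : 'I_N * 'I_q => x p.1 p.2 0 ^+ 2) beta x20 (ltW be1).
rewrite -energyE card_prod !card_ord in Sa Sb.
set E := energy x in Sa Sb nY *; have E0 : 0 <= E by exact: energy_ge0.
have M0 : 0 < ((N * q)%:R : R) by apply: lt_le_trans M_ge1.
(* The convex power mean, solved for the sum of powers, gives the factor [(N q)^(1 - beta)] of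
   [c1]. *)
have Sb' : (N * q)%:R `^ (1 - beta) * E `^ beta <=
    \sum_(p : 'I_N * 'I_q) (x p.1 p.2 0 ^+ 2) `^ beta.
  have -> : 1 - beta = - (beta - 1) by ring.
  by rewrite powRN mulrC ler_pdivrMr ?powR_gt0 // mulrC.
have ff : mu1 ^+ 2 * E + mu2 ^+ 2 * E `^ alpha + mu3 ^+ 2 * ((N * q)%:R `^ (1 - beta)) * E `^ beta
    <= \sum_i \sum_l f i l ^+ 2.
  apply: (@le_trans _ _ (\sum_(p : 'I_N * 'I_q) (mu1 ^+ 2 * x p.1 p.2 0 ^+ 2 +
      mu2 ^+ 2 * (x p.1 p.2 0 ^+ 2) `^ alpha + mu3 ^+ 2 * (x p.1 p.2 0 ^+ 2) `^ beta))).
    rewrite !big_split /= -!mulr_sumr -energyE -/E.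
    apply: lerD; first apply: lerD; first exact: lexx.
      by rewrite ler_wpM2l ?sqr_ge0.
    by rewrite -mulrA ler_wpM2l ?sqr_ge0.
  rewrite (pair_bigA _ (fun i l => f i l ^+ 2)) /=; apply: ler_sum => p _.
  by apply: sqr_force_ge; rewrite ?(ltW mu1_gt0) ?(ltW mu2_gt0) ?(ltW mu3_gt0).
rewrite /c1; set m := Num.min _ _.
have e1 : m * E <= (mu1 ^+ 2 - nKS ^+ 2) * E by rewrite ler_wpM2r // ge_min lexx.
have e2 : m * E `^ alpha <= mu2 ^+ 2 * E `^ alpha.
  by rewrite ler_wpM2r ?powR_ge0 // !ge_min lexx orbT.
have e3 : m * E `^ beta <= mu3 ^+ 2 * ((N * q)%:R `^ (1 - beta)) * E `^ beta.
  by rewrite ler_wpM2r ?powR_ge0 // !ge_min lexx !orbT.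
lra.
Qed.

End Lyapunov.

(** * The observer error in disagreement coordinates *)

Section Dynamics.
Variables (R : realType) (N q : nat) (S : 'M[R]_q) (a : 'M[R]_N.+1)
  (mu1 mu2 mu3 alpha beta t0 : R) (ta tk : nat -> R).
Hypotheses (adja : adjacency a) (alpha_gt0 : 0 < alpha) (beta_gt0 : 0 < beta).

Definition disagreement (v : 'cV[R]_q) (eta : 'I_N -> 'cV[R]_q) (i : 'I_N) : 'cV[R]_q :=
  \sum_j Hmat a i j *: (eta j - v).

(** Writing [eta i - eta j] as a difference of errors relative to [v] produces row [i] of [Hmat a];
    node [0] has zero error and contributes only to the diagonal. *)
Lemma hatvarsigmaE th v eta i :
  hatvarsigma a th v eta i = th *: disagreement v eta i.
Proof.
rewrite /hatvarsigma /disagreement big_ord_recl.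
have -> : ext v eta ord0 = v by rewrite /ext unlift_none.
have extE (j : 'I_N) : ext v eta (lift ord0 j) = eta j by rewrite /ext liftK.
under eq_bigr do rewrite extE.
have -> : \sum_j Hmat a i j *: (eta j - v) =
   (\sum_l a (agent i) (agent l) + a (agent i) ord0) *: (eta i - v)
   - \sum_(j < N) a (agent i) (agent j) *: (eta j - v).
  rewrite (bigD1 i) //= mxE eqxx; congr (_ + _).
  rewrite [in RHS](bigD1 i) //= (proj1 adja) scale0r add0r -sumrN.
  by apply: eq_bigr => j ji; rewrite mxE eq_sym (negPf ji) scaleNr.
have -> : \sum_(j < N) (a (agent i) (lift ord0 j) * th) *: (eta i - eta j) =
    th *: ((\sum_l a (agent i) (agent l)) *: (eta i - v))
    - th *: \sum_(j < N) a (agent i) (agent j) *: (eta j - v).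
  rewrite scaler_suml -scalerBr -sumrB scaler_sumr; apply: eq_bigr => j _.
  rewrite -scalerBr scalerA [th * _]mulrC; congr (_ *: _).
  by rewrite opprB addrA subrK.
rewrite [in RHS]scalerBr [in RHS]scalerDl [in RHS]scalerDr.
rewrite (mulrC (a _ _) th) -scalerA addrA.
by congr (_ - _); exact: addrC.
Qed.

(** Signed powers are not homogeneous of degree one; [th] factors out of them because it is [0] or
    [1]. *)
Lemma observer_rhsE th v eta i l : th = 0 \/ th = 1 ->
  observer_rhs S a mu1 mu2 mu3 alpha beta th v eta i l 0 =
  (S *m eta i) l 0 - th * force mu1 mu2 mu3 alpha beta (disagreement v eta i l 0).
Proof.
move=> th01; rewrite /observer_rhs hatvarsigmaE; set d := disagreement _ _ _.
case: th01 => ->; last first.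
  by rewrite scale1r mul1r !mxE /force /sgpow; ring.
by rewrite scale0r !mxE sgr0 !mul0r !mulr0 !subr0.
Qed.

Lemma vartheta01 t : vartheta ta tk t = 0 \/ vartheta ta tk t = 1 :> R.
Proof. by rewrite /vartheta; case: ifP => _; [left|right]. Qed.

Lemma is_derive_coord (f : R -> 'cV[R]_q) t d l :
  is_derive t (1 : R) f d -> is_derive t (1 : R) (fun s => f s l 0) (d l 0).
Proof.
move=> fd; have df := @ex_derive _ _ _ _ _ _ _ fd.
have dc := (derivable_mxP f t 1).1 df l 0.
have := derivableP dc; rewrite -(@derive_val _ _ _ _ _ _ _ fd) derive_mx // mxE.
by [].
Qed.

Section Solution.
Variables (k : 'I_N -> R) (v : R -> 'cV[R]_q) (eta : R -> 'I_N -> 'cV[R]_q).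
Hypothesis sol : is_solution S a mu1 mu2 mu3 alpha beta t0 ta tk v eta.

Let x t := disagreement (v t) (eta t).
Let H := Hmat a.
Let F := force mu1 mu2 mu3 alpha beta.

(** [Hmat a] mixes agents and [S] mixes components, so the two commute and the disagreement obeys a
    closed equation; the chain rule then gives the rate. *)
Lemma is_derive_lyap t : t0 < t -> ~ switching ta tk t ->
  is_derive t (1 : R) (fun s => lyap k mu1 mu2 mu3 alpha beta (x s))
    (lyap_rate S k H mu1 mu2 mu3 alpha beta (vartheta ta tk t) (x t)).
Proof.
move=> t0t nsw; have [dv [_ deta]] := sol.
set th := vartheta ta tk t.
have dx i l : is_derive t (1 : R) (fun s => x s i l 0)
    ((S *m x t i) l 0 - th * \sum_j H i j * F (x t j l 0)).
  have xE s : x s i l 0 = \sum_j H i j * (eta s j l 0 - v s l 0).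
    by rewrite /x /disagreement summxE; apply: eq_bigr => j _; rewrite !mxE.
  under eq_fun do rewrite xE.
  have D j := is_deriveZ (H i j)
    (is_deriveB (is_derive_coord l (deta t t0t nsw j)) (is_derive_coord l (dv t))).
  have := is_derive_bigsum (index_enum 'I_N) D.
  set r := \sum_(j <- _) _; rewrite (_ : _ - _ = r) //.
  rewrite /r; under [in RHS]eq_bigr => j _ do
    rewrite (observer_rhsE _ _ _ _ (vartheta01 t)) -/th -/(x t j).
  rewrite /x /disagreement mulmx_sumr summxE mulr_sumr -sumrB.
  apply: eq_bigr => j _; rewrite -scalemxAr mulmxBr !mxE /GRing.scale /= -/H -/F; ring.
have dp i l := is_derive1_comp
  (is_derive_potential mu1 mu2 mu3 (x t i l 0) alpha_gt0 beta_gt0) (dx i l).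
have D i := is_deriveZ (k i) (is_derive_bigsum (index_enum 'I_q) (dp i)).
exact: (is_derive_bigsum (index_enum 'I_N) D).
Qed.

Lemma continuous_lyap T :
  {within `[t0, T], continuous (fun s => lyap k mu1 mu2 mu3 alpha beta (x s))}.
Proof.
have [dv [ceta _]] := sol.
have coordv l : {within `[t0, T], continuous (fun s => v s l 0)}.
  apply: continuous_subspaceT => s; apply: differentiable_continuous.
  apply/derivable1_diffP.
  exact: (@ex_derive _ _ _ _ _ _ _ (is_derive_coord l (dv s))).
have coorde i l : {within `[t0, T], continuous (fun s => eta s i l 0)}.
  have sub : `[t0, T] `<=` `[t0, +oo[ by apply: subset_itvl; rewrite bnd_simp.
  have := continuous_subspaceW sub (ceta i).
  move=> /subspace_continuousP c; apply/subspace_continuousP => s Ts.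
  exact: (cvg_comp _ _ (c s Ts) (@coord_continuous _ _ _ l 0 (eta s i))).
apply: within_continuous_sum => i; apply: within_continuousZ.
apply: within_continuous_sum => l.
have cx : {within `[t0, T], continuous (fun s => x s i l 0)}.
  have xE s : x s i l 0 = \sum_j H i j * (eta s j l 0 - v s l 0).
    by rewrite /x /disagreement summxE; apply: eq_bigr => j _; rewrite !mxE.
  rewrite (funext xE).
  apply: within_continuous_sum => j; apply: within_continuousZ.
  exact: within_continuousB.
apply: (within_continuous_comp _ (fun s => x s i l 0)
  (potential mu1 mu2 mu3 alpha beta)) => // y _.
exact: potential_continuous.
Qed.

End Solution.

(* Testing the matrix inequality on the vectors of the l-th components of the
   errors shows that [Hmat a] is injective. *)
Lemma disagreement_eq0 (k : 'I_N -> R) v eta :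
  psd ((Hmat a)^T *m diag_mx (\row_i k i) + diag_mx (\row_i k i) *m Hmat a - 2%:M) ->
  (forall i, disagreement v eta i = 0) -> forall i, eta i = v.
Proof.
move=> psdH d0 i; apply/eqP; rewrite -subr_eq0; apply/eqP.
apply/matrixP => l j0; rewrite (ord1 j0) [in RHS]mxE.
have := psd_quadratic_le psdH (fun i => (eta i - v) l 0).
rewrite [X in _ <= X]big1 => [|i' _]; last first.
  suff -> : \sum_j Hmat a i' j * (eta j - v) l 0 = 0 by rewrite mulr0.
  transitivity (disagreement v eta i' l 0); last by rewrite d0 mxE.
  by rewrite /disagreement summxE; apply: eq_bigr => j _; rewrite [in RHS]mxE.
move=> le0; apply/eqP; rewrite -sqrf_eq0 eq_le sqr_ge0 andbT (le_trans _ le0) //.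
by rewrite [leRHS](bigD1 i) //= lerDl sumr_ge0 // => j _; exact: sqr_ge0.
Qed.

End Dynamics.

(** * From decay rates to extinction at the settling time *)

Lemma psi_lower_bound (R : realType) (A C P nu Th n att : R) :
  1 < P -> 0 <= C -> C < A * (P - 1) ->
  att <= nu + (n + att) / P -> Th * (P - 1) / P - nu <= n ->
  (A * (P - 1) - C) * Th / P - (A + C) * nu <= A * n - C * att.
Proof.
move=> P1 C0 CA attle nle.
have P0 : 0 < P by lra.
(* The excess is a nonnegative combination of the slacks in the bounds on [n] and [att]. *)
have E : A * n - C * att - ((A * (P - 1) - C) * Th / P - (A + C) * nu) =
  (A * (P - 1) - C) / (P - 1) * (n - (Th * (P - 1) / P - nu)) +
  C * P / (P - 1) * (nu + (n + att) / P - att).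
  by field; rewrite !gt_eqF //; lra.
rewrite -subr_ge0 E addr_ge0 //; apply: mulr_ge0; try lra.
  by rewrite divr_ge0 //; lra.
by rewrite divr_ge0 // ?mulr_ge0 //; lra.
Qed.

Lemma powR_div_expR (R : realType) (x r : R) :
  0 < x -> x `^ r / x = expR ((r - 1) * ln x).
Proof.
move=> x0; rewrite -[X in _ / X](powRr1 (ltW x0)) -powRB; last first.
  by rewrite (gt_eqF x0) implybT.
by rewrite /powR gt_eqF.
Qed.

(* Assumption (A1) bounds the attacked time from [t0] only, so attacks spared
   before [tbar_o] may be spent after it. The second phase is therefore started
   when the attack-free time [n] reaches the value [nst] that it takes at
   [tbar_o] under the worst attack, and the linear decay term is kept. *)
Lemma lyap_vanishes (R : realType) (t0 T A C G rho kap h P nu Th Tt : R)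
    (V att : R -> R) (s : seq R) :
  0 < rho -> 0 < A -> 0 <= C -> 0 <= G -> 0 < kap -> 0 < h -> 1 < P -> 0 < nu ->
  C < A * (P - 1) -> 0 < Th -> 0 < Tt -> t0 + Th + Tt <= T ->
  expR (kap * ((A * (P - 1) - C) * Th / P - (A + C) * nu)) = 1 + rho ->
  1 <= h * G * (Tt * (P - 1) / P) ->
  {within `[t0, T], continuous V} -> (forall z, 0 <= V z) ->
  {within `[t0, T], continuous att} -> att t0 = 0 ->
  (forall z, t0 <= z -> att z <= nu + (z - t0) / P) ->
  (forall z, t0 < z < T -> z \notin s -> exists2 d, is_derive z (1 : R) V d &
     [/\ is_derive z (1 : R) att 0, d <= 0,
        0 < V z -> d / V z <= - (A + A / rho * expR (kap * ln (V z))) &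
        0 < V z -> d / V z <= - (A + G * expR (- (h * ln (V z))))]
     \/ is_derive z (1 : R) att 1 /\ d <= C * V z) ->
  V T = 0.
Proof.
move=> rho0 A0 C0 G0 kap0 h0 P1 nu0 CA Th0 Tt0 TT lE hG cV V0 catt att0 attle dyn.
set l := (A * (P - 1) - C) * Th / P - (A + C) * nu in lE.
have P0 : 0 < P by lra.
have t0T : t0 <= T by lra.
apply/eqP; rewrite eq_le V0 andbT leNgt; apply/negP => VT.
(* [V u * expR (- C * u)] never increases, so a positive final value forces [V > 0] throughout, and
   [ln V] can be differentiated. *)
have Vpos z : t0 <= z <= T -> 0 < V z.
  move=> /andP[t0z zT].
  have : V T * expR (- C * T) <= V z * expR (- C * z).
    apply: (@nonincreasing_off_seq _ s (fun u => V u * expR (- C * u))) => //.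
      have sub : `[z, T] `<=` `[t0, T] by apply: subset_itvr; rewrite bnd_simp.
      have cV' := continuous_subspaceW sub cV.
      move=> u; apply: cvgM; first exact: cV'.
      apply: (@continuous_subspaceT _ _ _ (fun u => expR (- C * u))) => {}u.
      apply: (@continuous_comp _ _ _ ( *%R (- C)) expR); last exact: continuous_expR.
      exact: mulrl_continuous.
    move=> u /andP[zu uT] us.
    have [|d Vd Hd] := dyn u _ us; first by rewrite (le_lt_trans t0z).
    have De : is_derive u (1 : R) (fun u => expR (- C * u)) (expR (- C * u) * (- C)).
      apply: (@is_derive1_comp _ expR ( *%R (- C))).
      by have := is_deriveZ (- C) (is_derive_id u (1 : R)); rewrite /GRing.scale /= mulr1.
    have dC : d <= C * V u.
      case: Hd => [[_ d0 _ _]|[_ ->//]].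
      by apply: (le_trans d0); rewrite mulr_ge0.
    eexists; first exact: is_deriveM Vd De.
    rewrite /GRing.scale /=.
    have -> : V u * (expR (- C * u) * - C) + expR (- C * u) * d =
      expR (- C * u) * (d - C * V u) by ring.
    by rewrite mulr_ge0_le0 ?expR_ge0 // subr_le0.
  move=> /(lt_le_trans _); have := expR_gt0 (- C * z).
  move=> e1 /(_ 0); rewrite mulr_gt0 ?expR_gt0 // => /(_ isT).
  by rewrite pmulr_lgt0.
pose n z := z - t0 - att z.
pose nst := Th * (P - 1) / P - nu.
have nE z : att z = z - t0 - n z by rewrite /n; ring.
have cn : {within `[t0, T], continuous n}.
  apply: within_continuousB => //; apply: within_continuousB.
    by apply: (@continuous_subspaceT _ _ _ id) => u; exact: cvg_id.
  exact: within_continuous_cst.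
have lbound z : t0 <= z <= T -> nst <= n z -> l <= A * n z - C * (z - t0 - n z).
  move=> /andP[t0z _] nz; rewrite -nE; apply: psi_lower_bound => //.
  by have := attle z t0z; rewrite /n (_ : z - t0 - att z + att z = z - t0) //; ring.
have l0 : 0 < l.
  by rewrite -(pmulr_rgt0 _ kap0) -expR_gt1 lE; lra.
(* Needed for the intermediate value theorem: [n] starts at [0] and must reach [nst]. *)
have nst0 : 0 <= nst.
  have : A * nst = l + C * (nu + Th / P) by rewrite /nst /l; field; rewrite gt_eqF.
  have : 0 <= C * (nu + Th / P) by rewrite mulr_ge0 // addr_ge0 ?ltW // divr_gt0.
  by move=> h1 h2; rewrite -(pmulr_rge0 _ A0) h2; lra.
(* Over the whole interval the allowance [nu] is charged only once, and [nst] already contains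
   it. *)
have nT : nst + Tt * (P - 1) / P <= n T.
  have := attle T t0T; rewrite /n /nst => aT.
  have : Th * (P - 1) / P + Tt * (P - 1) / P <= (T - t0) * (P - 1) / P.
    by rewrite -!mulrDl ler_pM2r ?invr_gt0 // ler_pM2r; lra.
  have -> : (T - t0) * (P - 1) / P = T - t0 - (T - t0) / P by field; rewrite gt_eqF.
  lra.
have TtP : 0 <= Tt * (P - 1) / P by rewrite divr_ge0 ?mulr_ge0 //; lra.
have n0 : n t0 = 0 by rewrite /n att0; ring.
have cw : {within `[t0, T], continuous (fun z => ln (V z))}.
  move/subspace_continuousP : cV => cV; apply/subspace_continuousP => z Tz.
  apply: cvg_comp (cV z Tz) _; apply: continuous_ln; apply: Vpos.
  by move: Tz; rewrite /= in_itv.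
have nsT : nst <= n T by lra.
suff : h * G * (n T - nst) < 1.
  apply/negP; rewrite -leNgt (le_trans hG) // ler_wpM2l ?mulr_ge0 ?(ltW h0) //; lra.
apply: (no_survival t0T rho0 C0 kap0 h0 G0 lE cw cn n0 (s := s) (A := A)) => //.
move=> z /andP[t0z zT] zs.
have Vz : 0 < V z by apply: Vpos; rewrite !ltW.
have [|d Vd Hd] := dyn z _ zs; first by rewrite t0z.
have Dn da : is_derive z (1 : R) att da -> is_derive z (1 : R) n (1 - da).
  move=> ad; have D0 : is_derive z (1 : R) (fun u : R => u - t0) 1.
    by apply: is_derive_eq; rewrite ?subr0.
  exact: is_deriveB D0 ad.
exists ((V z)^-1 * d).
  by have D := @is_derive1_comp _ _ V z _ _ (is_derive1_ln Vz) Vd; exact D.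
case: Hd => [[/Dn an _ d1 d2]|[/Dn an d1]]; [left|right].
  by rewrite subr0 in an; rewrite mulrC; split=> //; [exact: d1|exact: d2].
by rewrite subrr in an; split=> //; rewrite mulrC ler_pdivrMr.
Qed.

(** * Fixed-time convergence of the distributed observers *)

Unset Implicit Arguments.
Set Strict Implicit.

Theorem theorem1 (R : realType) (N q : nat) (S : 'M[R]_q) (a : 'M[R]_N.+1)
  (t0 nu_d p_d : R) (ta tk : nat -> R)
  (k : 'I_N -> R)
  (alpha beta mu1 mu2 mu3 : R) (tbar_o t_o : R) :
  adjacency a ->
  dos_schedule t0 ta tk ->
  (* (A1) *)
  0 < nu_d -> 1 < p_d ->
  (forall t : R, t0 <= t ->
     (lebesgue_measure (PiD ta tk t) <= (nu_d + (t - t0) / p_d)%:E)%E) ->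
  (* (A2) *)
  has_spanning_tree_from0 a ->
  (* K = diag(k) > 0 with H^T K + K H - 2 I >= 0 *)
  (forall i, 0 < k i) ->
  let K : 'M[R]_N := diag_mx (\row_i k i) in
  psd ((Hmat a)^T *m K + K *m Hmat a - 2%:M) ->
  let kM := \big[Num.max/0]_(i < N) k i in
  let nKS := specnorm (kron K S) in
  let nS := specnorm S in
  0 < alpha -> alpha < 1 -> 1 < alpha^-1 -> alpha^-1 < beta ->
  0 < mu1 -> 0 < mu2 -> 0 < mu3 ->
  nKS < mu1 ->
  let C1 := c1 N q mu1 mu2 mu3 beta nKS in
  let C2 := c2 N q mu1 mu2 mu3 alpha beta kM in
  let C3 := c3 N q mu1 mu2 mu3 alpha beta kM in
  let C4 := c4 N q mu1 mu2 mu3 alpha beta kM in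
  let C5 := c5 q alpha beta nS in
  let hc1 := C1 * (1 - alpha) / (5 * C4 * (alpha + 1)) in
  let hc2 := C5 * (1 - alpha) / (alpha + 1) in
  let tc1 := C1 * (beta - 1) / (5 * C2 * (beta + 1)) in
  let tc2 := C5 * (beta - 1) / (beta + 1) in
  (* tbar_o and t_o are the solutions of the defining equations *)
  C2 * expR ((tc1 * (p_d - 1) - tc2) * (tbar_o - t0) / p_d - tc1 * nu_d - tc2 * nu_d)
    - C2 - C3 = 0 ->
  hc2 * expR (hc2 * ((t_o - tbar_o) / p_d + nu_d)) - hc1 * (p_d - 1) = 0 ->
  (* (i), (ii), (iii) *)
  C1 / (5 * C2) * (p_d - 1) - C5 > 0 ->
  hc2 * expR (hc2 * nu_d) - hc1 * (p_d - 1) < 0 ->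
  expR (hc2 * ((t_o - tbar_o) / p_d + nu_d)) - hc1 * (p_d - 1) / p_d * (t_o - tbar_o)
    + hc1 * nu_d <= 0 ->
  (* conclusion: fixed-time convergence for every solution / initial state *)
  forall (v : R -> 'cV[R]_q) (eta : R -> 'I_N -> 'cV[R]_q),
    is_solution S a mu1 mu2 mu3 alpha beta t0 ta tk v eta ->
    forall t : R, t_o <= t -> forall i : 'I_N, eta t i = v t.
Proof.
move=> adja dos nu0 P1 A1 _ k0 K psdH kM nKS nS al0 al1 _ albe mu10 mu20 mu30 nKSmu
  C1 C2 C3 C4 C5 hc1 hc2 tc1 tc2 Ebar Eo Hi Hii Hiii v eta sol t tot i.
(* For [q = 0] the states have no component; otherwise [N q >= 1], as the power-mean constants
   require. *)
have [q0|q0] := posnP q.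
  by apply/matrixP => -[l lq]; exfalso; rewrite q0 in lq.
have N0 : (0 < N)%N by apply: leq_ltn_trans (ltn_ord i).
have be1 : 1 < beta.
  by apply: lt_trans albe; rewrite invf_gt1.
have albe1 : 1 < alpha * beta by rewrite -ltr_pdivrMl // mulr1.
have be0 : 0 < beta by lra.
have kM0 : 0 < kM by apply: lt_le_trans (k0 i) _; exact: le_bigmax.
have M1 : 1 <= ((N * q)%:R : R) by rewrite ler1n muln_gt0 N0 q0.
have M0 : 0 < ((N * q)%:R : R) by apply: lt_le_trans M1.
set m1 := mu1 * kM / 2; set m2 := mu2 * kM / (alpha + 1); set m3 := mu3 * kM / (beta + 1).
have m10 : 0 < m1 by rewrite divr_gt0 ?mulr_gt0.
have m20 : 0 < m2 by rewrite divr_gt0 ?mulr_gt0 ?addr_gt0.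
have m30 : 0 < m3 by rewrite divr_gt0 ?mulr_gt0 ?addr_gt0.
have nKS0 : 0 <= nKS by exact: specnorm_ge0.
have C10 : 0 < C1.
  rewrite /C1 /c1 mulr_gt0 ?invr_gt0 // !lt_min !mulr_gt0 ?powR_gt0 ?exprn_gt0 // !andbT.
  by rewrite subr_gt0 ltr_sqr ?nnegrE // ltW.
have C20 : 0 < C2 by rewrite /C2 /c2 lt_max m10.
have C30 : 0 < C3.
  rewrite /C3 /c3 mulr_gt0 ?powR_gt0 ?lt_max ?m10 //.
  by rewrite ltr0n !muln_gt0 N0 q0.
have C40 : 0 < C4 by rewrite /C4 /c4 !lt_max powR_gt0 ?orbT.
have C50 : 0 <= C5.
  have b10 : 0 <= beta + 1 by lra.
  rewrite /C5 /c5; apply: mulr_ge0 => //; apply: mulr_ge0; last exact: specnorm_ge0.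
  by rewrite le_max powR_ge0.
have P0 : 0 < p_d by lra.
pose A := C1 / (5 * C2); pose G := C1 / (5 * C4); pose rho := C3 / C2.
pose kap := (beta - 1) / (beta + 1); pose h := (1 - alpha) / (alpha + 1).
have A0 : 0 < A by rewrite divr_gt0 // mulr_gt0.
have G0 : 0 < G by rewrite divr_gt0 // mulr_gt0.
have rho0 : 0 < rho by rewrite divr_gt0.
have kap0 : 0 < kap by rewrite divr_gt0 //; lra.
have h0 : 0 < h by rewrite divr_gt0 //; lra.
have tc1E : tc1 = kap * A by rewrite /tc1 /kap /A; field; rewrite !gt_eqF //; lra.
have tc2E : tc2 = kap * C5 by rewrite /tc2 /kap; field; rewrite !gt_eqF //; lra.
have hc1E : hc1 = h * G by rewrite /hc1 /h /G; field; rewrite !gt_eqF //; lra.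
have hc2E : hc2 = h * C5 by rewrite /hc2 /h; field; rewrite !gt_eqF //; lra.
have CA : C5 < A * (p_d - 1) by rewrite /A; move: Hi; lra.
pose Th := tbar_o - t0; pose Tt := t_o - tbar_o.
(* The defining equation of [tbar_o], divided by [C2]. *)
have lE : expR (kap * ((A * (p_d - 1) - C5) * Th / p_d - (A + C5) * nu_d)) = 1 + rho.
  have -> : kap * ((A * (p_d - 1) - C5) * Th / p_d - (A + C5) * nu_d) =
      (tc1 * (p_d - 1) - tc2) * (tbar_o - t0) / p_d - tc1 * nu_d - tc2 * nu_d.
    by rewrite tc1E tc2E /Th; field; rewrite gt_eqF.
  apply: (@mulfI _ C2); first by rewrite gt_eqF.
  have -> : C2 * (1 + rho) = C2 + C3 by rewrite /rho; field; rewrite gt_eqF.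
  by move: Ebar; lra.
have Th0 : 0 < Th.
  have l0 : 0 < (A * (p_d - 1) - C5) * Th / p_d - (A + C5) * nu_d.
    by rewrite -(pmulr_rgt0 _ kap0) -expR_gt1 lE; lra.
  have : 0 < (A * (p_d - 1) - C5) * Th / p_d.
    by apply: lt_le_trans l0 _; rewrite gerBl mulr_ge0 ?addr_ge0 // ltW.
  by rewrite pmulr_lgt0 ?invr_gt0 // pmulr_rgt0 // subr_gt0.
have hc10 : 0 < hc1 by rewrite hc1E mulr_gt0.
(* If [hc2] vanished, the equation of [t_o] would contradict [hc1 * (p_d - 1) > 0]. *)
have hc20 : 0 < hc2.
  rewrite lt_def hc2E mulr_ge0 ?(ltW h0) // andbT -hc2E; apply/eqP => E0.
  by have := Eo; rewrite E0 mul0r sub0r => /eqP; rewrite oppr_eq0 mulf_eq0 !gt_eqF //; lra.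
(* Condition (ii) compared with the equation of [t_o], by strict growth of the exponential. *)
have Tt0 : 0 < Tt.
  have : hc2 * expR (hc2 * nu_d) < hc2 * expR (hc2 * (Tt / p_d + nu_d)).
    by rewrite /Tt; lra.
  rewrite ltr_pM2l // ltr_expR ltr_pM2l // -subr_gt0 addrK.
  by rewrite pmulr_lgt0 ?invr_gt0.
(* Condition (iii), with the exponential bounded below by [1] and [hc1 * nu_d] by [0]. *)
have hG : 1 <= h * G * (Tt * (p_d - 1) / p_d).
  have e1 : 1 <= expR (hc2 * (Tt / p_d + nu_d)).
    rewrite -expR0 ler_expR mulr_ge0 ?(ltW hc20) // addr_ge0 ?(ltW nu0) //.
    by rewrite divr_ge0 // ltW.
  have e2 : 0 <= hc1 * nu_d by rewrite mulr_ge0 ?ltW.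
  have E : h * G * (Tt * (p_d - 1) / p_d) = hc1 * (p_d - 1) / p_d * Tt.
    by rewrite hc1E; ring.
  by rewrite E; move: Hiii; rewrite -/Tt; lra.
have Tend : t0 + Th + Tt <= t by rewrite /Th /Tt; move: tot; lra.
have [att [s [catt att0 attm datt]]] := attack_clock dos t.
pose x z := disagreement a (v z) (eta z).
pose V z := lyap k mu1 mu2 mu3 alpha beta (x z).
suff VT0 : V t = 0.
  apply: (disagreement_eq0 psdH) => j.
  exact: (lyap_eq0 k0 mu10 mu20 mu30 al0 be1 VT0).
apply: (@lyap_vanishes R t0 t A C5 G rho kap h p_d nu_d Th Tt V att s) => //; try exact: ltW.
- exact: (continuous_lyap al0 be0 sol).
- by move=> z; apply: lyap_ge0.
- by move=> z t0z; rewrite -lee_fin (le_trans (attm z)) // A1.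
move=> z /andP[t0z zt] zs; have [nsw dz] := datt z zt zs.
exists (lyap_rate S k (Hmat a) mu1 mu2 mu3 alpha beta (vartheta ta tk z) (x z)).
  exact: (is_derive_lyap adja al0 be0 k sol t0z nsw).
have [th|th] := vartheta01 ta tk z; rewrite th in dz *.
  right; rewrite subr0 in dz; split=> //.
  exact: lyap_rate_attack.
left; rewrite subrr in dz.
have free := @lyap_rate_free R N q S k (Hmat a) mu1 mu2 mu3 alpha beta N0 q0 mu10 mu20 mu30
  al0 al1 be1 (x z) psdH.
set rate := lyap_rate _ _ _ _ _ _ _ _ _ _ in free *.
have E0 := energy_ge0 (x z).
have V0 : 0 <= V z by exact: lyap_ge0.
have Vle := @lyap_le_energy R N q k mu1 mu2 mu3 alpha beta mu10 mu20 mu30 al0 al1 be1 (x z).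
rewrite -/nKS -/C1 in free; set E := energy (x z) in free E0 Vle.
have Vlin : V z / C2 <= 3 * E + E `^ alpha + E `^ beta.
  exact: (linear_rate m10 al0 al1 albe1 E0 Vle).
have Vsup : V z `^ (2 * beta / (beta + 1)) / C3 <= 2 * E + 3 * E `^ beta.
  rewrite /C3 /c3 -mulnA natrM.
  exact: (superlinear_rate m10 M1 al0 al1 albe1 E0 V0 Vle).
have Vsub : V z `^ (2 * alpha / (alpha + 1)) / C4 <= 2 * E + 2 * E `^ alpha + E `^ beta.
  exact: (sublinear_rate m10 m20 m30 M1 al0 al1 albe1 E0 V0 Vle).
have Ea := powR_ge0 E alpha; have Eb := powR_ge0 E beta.
(* Both decay bounds have this form, [y] being the linear estimate plus one nonlinear estimate. *)
have rate_le (y : R) : y <= 5 * (E + E `^ alpha + E `^ beta) -> rate <= - (C1 / 5 * y).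
  move=> yE; apply: (le_trans free); rewrite lerN2 -mulrA ler_pM2l //.
  by rewrite mulrC ler_pdivrMr // mulrC.
split=> //.
- by apply: (le_trans free); rewrite oppr_le0 mulr_ge0 ?(ltW C10) // !addr_ge0.
- move=> Vz; have -> : kap = 2 * beta / (beta + 1) - 1.
    by rewrite /kap; field; rewrite gt_eqF //; lra.
  rewrite -powR_div_expR // ler_pdivrMr //.
  have -> : - (A + A / rho * (V z `^ (2 * beta / (beta + 1)) / V z)) * V z =
      - (C1 / 5 * (V z / C2 + V z `^ (2 * beta / (beta + 1)) / C3)).
    by rewrite /A /rho; field; rewrite !gt_eqF.
  by apply: rate_le; lra.
- move=> Vz; have -> : - (h * ln (V z)) = (2 * alpha / (alpha + 1) - 1) * ln (V z).
    by rewrite /h; field; rewrite gt_eqF //; lra.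
  rewrite -powR_div_expR // ler_pdivrMr //.
  have -> : - (A + G * (V z `^ (2 * alpha / (alpha + 1)) / V z)) * V z =
      - (C1 / 5 * (V z / C2 + V z `^ (2 * alpha / (alpha + 1)) / C4)).
    by rewrite /A /G; field; rewrite !gt_eqF.
  by apply: rate_le; lra.
Qed.
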